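(* Let $f\in\mathcal{A}(\Omega)$ and $b\in\mathbb{R}$ satisfy $f-E_kf\le b$ on $\Omega$ for all $k\in\{1,\dots,n\}$. Then for all $t>0$ $$\Pr\{f-Ef>t\}\le\exp\left(\frac{-t^2}{2\sigma^2(f)+J^2(f)/2+\left(2b/3+J_\mu(f)\right)t}\right),$$ where $J^2(f)=(J(f))^2$.
   Context: Let $\Omega=\prod_{k=1}^n\Omega_k$ be a product of measurable spaces, let $\mu_k$ be a probability measure on $\Omega_k$ and $\mu=\prod_k\mu_k$ the product measure on $\Omega$. $\mathcal{A}(\Omega)$ is the algebra of all bounded measurable real-valued functions on $\Omega$. $\Pr$ and $E$ refer to $\mu$: $Ef=\int_\Omega f\,d\mu$, and $\sigma^2(f)=E[(f-Ef)^2]$. For $k\in\{1,\dots,n\}$ and $y,y'\in\Omega_k$, $(S_y^kf)(x_1,\dots,x_n)=f(x_1,\dots,x_{k-1},y,x_{k+1},\dots,x_n)$ and $D^k_{y,y'}=S^k_y-S^k_{y'}$. $E_kf=\int_{\Omega_k}S_y^kf\,d\mu_k(y)$ and $\sigma_k^2(f)=E_k[(f-E_kf)^2]$ (functions on $\Omega$ not depending on $x_k$). The interaction functional and the distribution-dependent interaction functional are $$J(f)=\left(\sup_{\mathbf{x}\in\Omega}\sum_{k,l:k\ne l}\ \sup_{z,z'\in\Omega_l}\ \sup_{y,y'\in\Omega_k}\left(D^l_{z,z'}D^k_{y,y'}f\right)^2(\mathbf{x})\right)^{1/2},$$ $$J_\mu(f)=2\left(\sup_{\mathbf{x}\in\Omega}\sum_{l}\sup_{z\in\Omega_l}\sum_{k:k\ne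 l}\sigma_k^2\left(f-S_z^lf\right)(\mathbf{x})\right)^{1/2},$$ with $k,l$ ranging over $\{1,\dots,n\}$. If the denominator in the exponent is zero, the exponent is read as $-\infty$. *)

(* Defs.v *)
From HB Require Import structures.
From mathcomp Require Import all_boot all_order all_algebra.
From mathcomp Require Import all_classical all_reals all_analysis.

Set Implicit Arguments.
Unset Strict Implicit.
Unset Printing Implicit Defensive.
Import Order.TTheory GRing.Theory Num.Theory.
Import numFieldNormedType.Exports.

Local Open Scope classical_set_scope.
Local Open Scope ring_scope.

Definition cylinders n (d : 'I_n -> measure_display)
    (Omega : forall k, measurableType (d k)) : set (set (forall k, Omega k)) :=
  \bigcup_k preimage_set_system setT (fun x : forall k, Omega k => x k)
              measurable.
Arguments cylinders {n d} Omega.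

(* The factors may be pairwise different spaces, so points of the product are
   dependent functions [x : forall k, Omega k]; [dfwith x k y] is the point [x]
   with its coordinate of index [k] replaced by [y : Omega k]. *)
Definition product_space n (d : 'I_n -> measure_display)
    (Omega : forall k, measurableType (d k)) : measurableType _ :=
  g_sigma_algebraType (cylinders Omega).
Arguments product_space {n d} Omega.

(* A measure with these values is unique: the rectangles form a pi-system that
   generates the sigma-algebra of [product_space Omega]. *)
Definition is_product_measure (R : realType) n (d : 'I_n -> measure_display)
    (Omega : forall k, measurableType (d k))
    (mu_ : forall k, probability (Omega k) R)
    (mu : probability (product_space Omega) R) : Prop :=
  forall A : (forall k, set (Omega k)), (forall k, measurable (A k)) ->
    mu [set x | forall k, A k (x k)] = (\prod_(k < n) mu_ k (A k))%E.

Definition bounded_measurable (R : realType) d (T : measurableType d)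
    (f : T -> R) : Prop :=
  measurable_fun setT f /\ bounded_fun f.

Section operators.
Context (R : realType) (n : nat) (d : 'I_n -> measure_display)
  (Omega : forall k, measurableType (d k)).
Implicit Types (f : product_space Omega -> R) (x : product_space Omega).

Definition subst_op k (y : Omega k) f : product_space Omega -> R :=
  fun x => f (dfwith x k y).

Definition diff_op k (y y' : Omega k) f : product_space Omega -> R :=
  subst_op y f \- subst_op y' f.

(* Real-valued [sup] is the true supremum of a nonempty bounded set (and is 0
   on other sets); every supremum below is over such a set when [f] is
   bounded and measurable. *)
Definition interaction f : R :=
  Num.sqrt (sup [set
    \sum_(k < n) \sum_(l < n | k != l)
      sup [set sup [set (diff_op z z' (diff_op y y' f) x) ^+ 2
                   | y in [set: Omega k] & y' in [set: Omega k]]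
          | z in [set: Omega l] & z' in [set: Omega l]]
    | x in [set: product_space Omega]]).

Variable mu_ : forall k, probability (Omega k) R.

Definition cond_expectation k f : product_space Omega -> R :=
  fun x => \int[mu_ k]_y subst_op y f x.

Definition cond_variance k f : product_space Omega -> R :=
  cond_expectation k (fun x => (f x - cond_expectation k f x) ^+ 2).

Definition interaction_mu f : R :=
  2 * Num.sqrt (sup [set
    \sum_(l < n)
      sup [set \sum_(k < n | k != l) cond_variance k (f \- subst_op z f) x
          | z in [set: Omega l]]
    | x in [set: product_space Omega]]).

End operators.

(* The exponent [- a / c], read as [-oo] when [c = 0]. *)
Definition neg_quotient (R : realType) (a c : R) : \bar R :=
  if c == 0 then -oo%E else (- a / c)%:E.

(* Main.v *)
Require Import Defs.
From mathcomp Require Import all_boot all_order all_algebra.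
From mathcomp Require Import all_classical all_reals all_analysis.
From mathcomp Require Import measurable_realfun ring lra.

(** The proof is by the entropy method. Write [g] for the sum over [k] of the
    conditional variances of [f], [V] for its mean, [a] for [interaction_mu] and
    [c = b / 3 + a / 2].

    For bounded [h], [ent mu h] is the entropy of the density proportional to
    [expR h], times its normalization. The logarithm [L s] of the expectation of
    [expR (s * f)] satisfies
    [(L s / s)^`() = ent mu (s * f) / (s ^+ 2 * expR (L s))], so that an upper
    bound on the entropy at every small [s] integrates to an upper bound on [L]
    (Herbst's argument, [lmgf_herbst]), and Markov's inequality for
    [expR (s * f)] gives the tail bound.

    The entropy is bounded as follows. Entropy is at most the mean of the
    sum of the conditional entropies ([ent_tensorization]). On each fiber
    [f - E_k f <= b], and a Bennett type estimate of the conditional entropies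
    ([ent_bennett]) bounds the entropy at [s * f] by [r ^+ 2 / 2] times the integral
    of [g * expR (s * f)], with [r = s / (1 - s * b / 3)] ([ent_bernstein]). Here
    [g] is integrated against the tilted measure. The variational inequality
    [ent_dv] replaces this integral by the entropy itself and by exponential
    moments of [g] under [mu], and the entropy term is absorbed by the left side
    ([decoupled_entropy_bound]).

    The exponential moments of [g] of order less than [2 / a ^+ 2] are controlled
    by its mean because [g] is self-bounding: the squared decreases of [g] that
    result from changing one coordinate of [x] add up to at most [a ^+ 2 * g x]
    ([variance_sum_self_bounding]). A modified logarithmic Sobolev inequality
    then gives a differential inequality for the log-moment generating function of
    [g] ([lmgf_self_bounded]). As infima over a coordinate need not be measurable,
    essential infima take their place. The outcome is
    [L s <= s * E f + s ^+ 2 / 2 * (V / (1 - c * s))] ([lmgf_le_variance]).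

    It remains to compare [V] with the variance of [f]. The conditional
    expectations are commuting orthogonal projections of L2; telescoping the
    variance along the coordinates shows that [V] exceeds it by at most half the
    sum, over ordered pairs of distinct indices, of squared norms of twice
    centered functions ([reverse_efron_stein]), and these squared norms are
    controlled by mixed second differences ([interaction_bound]):
    [V <= variance + interaction ^+ 2 / 4]. *)

Set Implicit Arguments.
Unset Strict Implicit.
Unset Printing Implicit Defensive.
Import Order.TTheory GRing.Theory Num.Theory.
Import numFieldNormedType.Exports.

Local Open Scope classical_set_scope.
Local Open Scope ring_scope.

(** * Elementary inequalities *)

Section monotone.
Context {R : realType}.

Lemma nondecreasing_of_derive (f f' : R -> R) (a b : R) :
  a <= b -> (forall x, a <= x -> x <= b -> is_derive x 1 f (f' x)) ->
  (forall x, a < x -> x < b -> 0 <= f' x) -> f a <= f b.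
Proof.
move=> ab df f'0.
have df1 x : x \in `]a, b[ -> derivable f x 1.
  by rewrite in_itv/= => /andP[/ltW ax /ltW xb]; have [] := df x ax xb.
apply: (ger0_derive1_le_cc df1) => //; rewrite ?in_itv/= ?lexx ?ab//.
  move=> x; rewrite in_itv/= => /andP[ax xb].
  by rewrite derive1E (@derive_val _ _ _ _ _ _ _ (df x (ltW ax) (ltW xb))) f'0.
apply: derivable_within_continuous => x; rewrite in_itv/= => /andP[ax xb].
by have [] := df x ax xb.
Qed.

(** The right side minus the left side vanishes at 0 and has derivative
    [x - 1 + expR (- x)], which is nonnegative. *)
Lemma expRN_le_quad (x : R) : 0 <= x -> expR (- x) - 1 + x <= x ^+ 2 / 2.
Proof.
move=> x0.
pose F (y : R) := y ^+ 2 / 2 - y - expR (- y).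
have : F 0 <= F x.
  apply: (@nondecreasing_of_derive F (fun y => y - 1 + expR (- y))) => // y y0 yx.
    rewrite /F; apply: is_derive_eq; rewrite !scaler1/GRing.scale/=; lra.
  by have := expR_ge1Dx (- y); lra.
rewrite /F oppr0 expR0; lra.
Qed.

(** The left side minus the right side vanishes at 0 and has derivative
    [x * (expR x - 1)], which is nonnegative. *)
Lemma bennett_quad_neg (x : R) : x <= 0 -> x * expR x - expR x + 1 <= x ^+ 2 / 2.
Proof.
move=> x0.
pose F (y : R) := y * expR y - expR y - y ^+ 2 / 2.
have : F x <= F 0.
  apply: (@nondecreasing_of_derive F (fun y => y * (expR y - 1))) => // y xy y0.
    rewrite /F; apply: is_derive_eq; rewrite !scaler1/GRing.scale/=; lra.
  rewrite mulr_le0 ?(ltW y0)// subr_le0 -expR0 ler_expR; exact: ltW.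
rewrite /F expR0; lra.
Qed.

(** The left side has derivative [x * expR x] and the right side
    [x / (1 - x / 3) ^+ 3]; the former is smaller because
    [1 - x / 3 <= expR (- x / 3)]. This is where the 3 of Bernstein's
    inequality comes from. *)
Lemma bennett_quad_pos (x : R) : 0 <= x < 3 ->
  x * expR x - expR x + 1 <= x ^+ 2 / 2 / (1 - x / 3) ^+ 2.
Proof.
move=> /andP[x0 x3].
pose F (y : R) := y ^+ 2 / 2 * (1 - y / 3) ^- 2 - (y * expR y - expR y).
have : F 0 <= F x.
  apply: (@nondecreasing_of_derive F (fun y => y * ((1 - y / 3) ^- 3 - expR y))) => // y y0 yx.
    have h : 1 - y / 3 != 0 by rewrite gt_eqF//; lra.
    have h2 : (1 - y / 3) ^+ 2 != 0 by rewrite expf_neq0.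
    rewrite /F; apply: is_derive_eq; rewrite !scaler1/GRing.scale/=; field; lra.
  have y3 : 0 < 1 - y / 3 by lra.
  rewrite mulr_ge0 ?(ltW y0)// subr_ge0.
  have : 1 - y / 3 <= expR (- (y / 3)) by exact: expR_ge1Dx.
  rewrite expRN => h.
  have : expR (y / 3) <= (1 - y / 3)^-1.
    by rewrite -[leLHS]invrK lef_pV2// ?posrE// invr_gt0 expR_gt0.
  move=> /(lerXn2r 3); rewrite !nnegrE expR_ge0 invr_ge0 (ltW y3) => /(_ isT isT).
  by rewrite -expRM_natl exprVn mulrC divfK.
rewrite /F expR0; lra.
Qed.

Lemma bennett_quad (x c : R) : x <= c -> 0 <= c < 3 ->
  x * expR x - expR x + 1 <= x ^+ 2 / 2 / (1 - c / 3) ^+ 2.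
Proof.
move=> xc /andP[c0 c3].
have hc : 0 < 1 - c / 3 by lra.
have x2 : 0 <= x ^+ 2 / 2 by rewrite divr_ge0// sqr_ge0.
have [x0|x0] := leP x 0.
  apply: (le_trans (bennett_quad_neg x0)).
  rewrite ler_peMr// invf_ge1 ?exprn_gt0//.
  by rewrite expr_le1//; lra.
apply: (le_trans (bennett_quad_pos _)); first by rewrite ltW//=; lra.
rewrite ler_wpM2l// lef_pV2 ?posrE ?exprn_gt0//; last by lra.
by rewrite lerXn2r// ?nnegrE; lra.
Qed.

End monotone.

(** * Bounded measurable functions *)

Section bounded_measurable.
Context {R : realType} {d : measure_display} {T : measurableType d}.
Implicit Types f g : T -> R.

Lemma bmP f : bounded_measurable f <->
  measurable_fun setT f /\ exists M : R, forall x, `|f x| <= M.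
Proof.
split=> [[mf [M [_ hM]]]|[mf [M hM]]]; split => //.
  by exists (M + 1) => x; apply: hM => //; rewrite ltrDl.
by exists M; split => //; [exact: num_real|move=> N MN x _; apply: le_trans (hM x) (ltW MN)].
Qed.

Lemma bm_cst (c : R) : bounded_measurable (fun _ : T => c).
Proof. by apply/bmP; split=> //; exists `|c|. Qed.

Lemma bmD f g : bounded_measurable f -> bounded_measurable g ->
  bounded_measurable (fun x => f x + g x).
Proof.
move=> /bmP[mf [M hM]] /bmP[mg [N hN]]; apply/bmP; split.
  exact: measurable_funD.
by exists (M + N) => x; rewrite (le_trans (ler_normD _ _))// lerD.
Qed.

Lemma bmM f g : bounded_measurable f -> bounded_measurable g ->
  bounded_measurable (fun x => f x * g x).
Proof.
move=> /bmP[mf [M hM]] /bmP[mg [N hN]]; apply/bmP; split.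
  exact: measurable_funM.
by exists (M * N) => x; rewrite normrM ler_pM.
Qed.

Lemma bmN f : bounded_measurable f -> bounded_measurable (fun x => - f x).
Proof.
move=> /bmP[mf [M hM]]; apply/bmP; split; first exact: measurableT_comp.
by exists M => x; rewrite normrN.
Qed.

Lemma bmX n f : bounded_measurable f -> bounded_measurable (fun x => f x ^+ n).
Proof.
move=> /bmP[mf [M hM]]; apply/bmP; split; first exact: measurable_funX.
by exists (M ^+ n) => x; rewrite normrX lerXn2r// nnegrE// (le_trans _ (hM x)).
Qed.

Lemma bm_expR f : bounded_measurable f -> bounded_measurable (fun x => expR (f x)).
Proof.
move=> /bmP[mf [M hM]]; apply/bmP; split; first exact: measurableT_comp.
exists (expR M) => x; rewrite ger0_norm ?expR_ge0// ler_expR.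
by rewrite (le_trans _ (hM x))// ler_norm.
Qed.

Lemma bm_max f g : bounded_measurable f -> bounded_measurable g ->
  bounded_measurable (fun x => Num.max (f x) (g x)).
Proof.
move=> /bmP[mf [M hM]] /bmP[mg [N hN]]; apply/bmP; split.
  exact: measurable_maxr.
exists (Num.max M N) => x; rewrite le_max.
by case: (leP (f x) (g x)) => _; rewrite ?hM ?hN ?orbT.
Qed.

Lemma bm_sum (I : Type) (s : seq I) (p : pred I) (F : I -> T -> R) :
  (forall i, bounded_measurable (F i)) ->
  bounded_measurable (fun x => \sum_(i <- s | p i) F i x).
Proof.
move=> bF; elim: s => [|i s IH].
  by under eq_fun do rewrite big_nil; exact: bm_cst.
under eq_fun do rewrite big_cons; case: (p i) => //; exact: bmD.
Qed.

Lemma bm_ln f (c : R) : 0 < c -> (forall x, c <= f x) -> bounded_measurable f ->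
  bounded_measurable (fun x => ln (f x)).
Proof.
move=> c0 cf /bmP[mf [M hM]]; apply/bmP; split.
  exact: measurableT_comp.
exists (`|ln c| + `|ln M|) => x.
have fx0 : 0 < f x := lt_le_trans c0 (cf x).
have fM : f x <= M := le_trans (ler_norm _) (hM x).
have lo : ln c <= ln (f x) by rewrite ler_ln ?posrE.
have hi : ln (f x) <= ln M by rewrite ler_ln ?posrE// (lt_le_trans fx0).
rewrite ler_norml; apply/andP; split.
  by rewrite (le_trans _ lo)//; have := ler_norm (- ln c); rewrite normrN;
    have := normr_ge0 (ln M); lra.
by rewrite (le_trans hi)//; have := ler_norm (ln M); have := normr_ge0 (ln c); lra.
Qed.

End bounded_measurable.

(** Proves that an expression is bounded and measurable by following its syntax;
    a subexpression that is not in the context is left as a goal. *)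
Ltac bm := match goal with
| |- bounded_measurable _ => assumption
| |- bounded_measurable (fun=> ?c) => exact: bm_cst
| |- bounded_measurable (fun x => @?f x + @?g x) => apply: (@bmD _ _ _ f g); bm
| |- bounded_measurable (fun x => @?f x * @?g x) => apply: (@bmM _ _ _ f g); bm
| |- bounded_measurable (fun x => - @?f x) => apply: (@bmN _ _ _ f); bm
| |- bounded_measurable (fun x => @?f x ^+ ?n) => apply: (@bmX _ _ _ n f); bm
| |- bounded_measurable (fun x => expR (@?f x)) => apply: (@bm_expR _ _ _ f); bm
| |- bounded_measurable (fun x => Num.max (@?f x) (@?g x)) =>
   apply: (@bm_max _ _ _ f g); bm
| |- bounded_measurable (fun x => \sum_(i <- ?s | @?p i) @?f x i) =>
   apply: (@bm_sum _ _ _ _ s p (fun i x => f x i)); move=> ?; bm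
| _ => idtac end.

(** Turns the integrals of the goal into variables: [ring] and [lra] would
    otherwise try to identify them by computation. *)
Ltac abstract_integrals := repeat match goal with
| |- context [@Rintegral ?d ?T ?R ?m ?D ?f] =>
  generalize (@Rintegral d T R m D f); intro end.

(** * Expectation, log-moment generating function and entropy *)

Section expectation.
Context {R : realType} {d : measure_display} {T : measurableType d}
  (P : probability T R).
Implicit Types f g : T -> R.

Lemma bm_integrable f : bounded_measurable f -> P.-integrable setT (EFin \o f).
Proof.
move=> [mf bf]; apply: measurable_bounded_integrable => //.
by rewrite [ltLHS]probability_setT ltry.
Qed.

Lemma E_cst (c : R) : \int[P]_x c = c.
Proof. by rewrite Rintegral_cst// [X in fine X]probability_setT mulr1. Qed.

Lemma E_eq f g : (forall x, f x = g x) -> \int[P]_x f x = \int[P]_x g x.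
Proof. by move=> fg; apply: eq_Rintegral. Qed.

Lemma ED f g : bounded_measurable f -> bounded_measurable g ->
  \int[P]_x (f x + g x) = \int[P]_x f x + \int[P]_x g x.
Proof. by move=> bf bg; rewrite RintegralD//; exact: bm_integrable. Qed.

Lemma EZ (c : R) f : bounded_measurable f ->
  \int[P]_x (c * f x) = c * \int[P]_x f x.
Proof. by move=> bf; rewrite RintegralZl//; exact: bm_integrable. Qed.

Lemma EZr (c : R) f : bounded_measurable f ->
  \int[P]_x (f x * c) = (\int[P]_x f x) * c.
Proof. by move=> bf; rewrite RintegralZr//; exact: bm_integrable. Qed.

Lemma EB f g : bounded_measurable f -> bounded_measurable g ->
  \int[P]_x (f x - g x) = \int[P]_x f x - \int[P]_x g x.
Proof. by move=> bf bg; rewrite RintegralB//; exact: bm_integrable. Qed.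

Lemma E_sum (I : Type) (s : seq I) (p : pred I) (F : I -> T -> R) :
  (forall i, bounded_measurable (F i)) ->
  \int[P]_x (\sum_(i <- s | p i) F i x) = \sum_(i <- s | p i) \int[P]_x F i x.
Proof.
move=> bF; elim: s => [|i s IH].
  by rewrite big_nil; under eq_Rintegral do rewrite big_nil; rewrite E_cst.
rewrite big_cons; under eq_Rintegral do rewrite big_cons.
by case: (p i) => //; rewrite ED ?IH//; exact: bm_sum.
Qed.

Lemma E_le f g : bounded_measurable f -> bounded_measurable g ->
  (forall x, f x <= g x) -> \int[P]_x f x <= \int[P]_x g x.
Proof. by move=> bf bg fg; apply: le_Rintegral => //; exact: bm_integrable. Qed.

Lemma E_ge0 f : (forall x, 0 <= f x) -> 0 <= \int[P]_x f x.
Proof. by move=> f0; apply: Rintegral_ge0. Qed.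

Lemma E_norm_le f (M : R) : bounded_measurable f -> (forall x, `|f x| <= M) ->
  `|\int[P]_x f x| <= M.
Proof.
move=> bf fM; rewrite ler_norml -(E_cst (- M)) -[X in _ && (_ <= X)](E_cst M).
by apply/andP; split; apply: E_le; try bm; move=> x;
  have := fM x; rewrite ler_norml => /andP[].
Qed.

Lemma E_ae_le f g : bounded_measurable f -> bounded_measurable g ->
  {ae P, forall x, f x <= g x} -> \int[P]_x f x <= \int[P]_x g x.
Proof.
move=> bf bg fg; pose h x := Num.max (f x) (g x).
have bh : bounded_measurable h by rewrite /h; bm.
have -> : \int[P]_x g x = \int[P]_x h x.
  rewrite /Rintegral; congr fine; apply: ae_eq_integral => //.
  - by apply/measurable_EFinP; case: bg.
  - by apply/measurable_EFinP; case: bh.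
  - by apply: filterS fg => x fgx _; rewrite /h max_r.
by apply: E_le => // x; rewrite /h le_max lexx.
Qed.

Lemma E_expR_gt0 f : bounded_measurable f -> 0 < \int[P]_x expR (f x).
Proof.
move=> /[dup] bf /bmP[mf [M hM]].
rewrite (lt_le_trans (expR_gt0 (- M)))// -(E_cst (expR (- M))).
apply: E_le; try bm; move=> x; rewrite ler_expR.
by have := hM x; rewrite ler_norml => /andP[].
Qed.

Definition lmgf f : R := ln (\int[P]_x expR (f x)).

Lemma expR_lmgf f : bounded_measurable f -> expR (lmgf f) = \int[P]_x expR (f x).
Proof. by move=> bf; rewrite /lmgf lnK// posrE E_expR_gt0. Qed.

Lemma lmgfB f (c : R) : bounded_measurable f ->
  lmgf (fun x => f x - c) = lmgf f - c.
Proof.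
move=> bf; rewrite /lmgf.
rewrite (@E_eq _ (fun x => expR (f x) * expR (- c))); last first.
  by move=> x; rewrite expRD.
by rewrite EZr; [rewrite lnM ?posrE ?expR_gt0 ?E_expR_gt0// expRK | bm].
Qed.

(** Jensen's inequality, from [1 + y <= expR y] at [y = f x - E f]. *)
Lemma lmgf_ge f : bounded_measurable f -> \int[P]_x f x <= lmgf f.
Proof.
move=> bf; set m := \int[P]_x f x.
have : expR m * 1 <= expR m * \int[P]_x expR (f x - m).
  rewrite ler_wpM2l ?expR_ge0//.
  have <- : \int[P]_x (1 + (f x - m)) = 1.
    by rewrite ED ?EB ?E_cst; try bm; rewrite -/m; ring.
  by apply: E_le; try bm; move=> x; rewrite expR_ge1Dx.
rewrite -EZ ?mulr1; last by bm.
under eq_Rintegral do rewrite -expRD addrC subrK.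
by rewrite -expR_lmgf// ler_expR.
Qed.

(** The entropy of the density proportional to [expR f], times its mass. *)
Definition ent f : R :=
  \int[P]_x (f x * expR (f x)) - (\int[P]_x expR (f x)) * lmgf f.

(** The variational (Donsker-Varadhan) inequality: it trades the expectation of
    [u] under the density proportional to [expR f] for the log-moment generating
    function of [u] under [P], at the cost of an entropy. It integrates
    [y <= expR y - 1], where [y] is the logarithm of the quotient of the
    normalized densities [expR u] and [expR f]. *)
Lemma ent_dv f u : bounded_measurable f -> bounded_measurable u ->
  \int[P]_x (u x * expR (f x)) <= ent f + (\int[P]_x expR (f x)) * lmgf u.
Proof.
move=> bf bu; rewrite /ent.
move: (expR_lmgf bf) (expR_lmgf bu); move: (lmgf f) (lmgf u) => a b ea eb.
have : \int[P]_x ((u x - b - f x + a) * expR (f x)) <=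
       \int[P]_x (expR (u x) * expR (a - b) - expR (f x)).
  apply: E_le; try bm; move=> x.
  have -> : expR (u x) * expR (a - b) = expR (u x - b - f x + a) * expR (f x).
    by rewrite -[LHS]expRD -[RHS]expRD; congr expR; ring.
  set y := u x - b - f x + a; rewrite -[X in _ <= _ - X]mul1r -mulrBl.
  by rewrite ler_pM2r ?expR_gt0// lerBrDr addrC expR_ge1Dx.
rewrite (@E_eq _ (fun x => u x * expR (f x) -
  f x * expR (f x) + (a - b) * expR (f x))); last by move=> x; ring.
rewrite ED ?EB ?EZ ?EZr; try bm; rewrite -eb -ea.
have -> : expR b * expR (a - b) = expR a by rewrite -expRD addrC subrK.
abstract_integrals; lra.
Qed.

Lemma ent_ge0 f : bounded_measurable f -> 0 <= ent f.
Proof.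
move=> bf; have := @ent_dv f (fun=> 0) bf (bm_cst 0).
rewrite (@E_eq _ (fun=> 0)); last by move=> x; rewrite mul0r.
by rewrite /lmgf [in ln _](@E_eq _ (fun=> expR 0))// !E_cst expR0 ln1 mulr0 addr0.
Qed.

(** Entropy is the minimum over [c] of the right side, reached at [c = lmgf f].
    A constant [c] that fits the problem gives a bound by the integral of an
    explicit function; the two lemmas that follow are such bounds. *)
Lemma ent_le f (c : R) : bounded_measurable f ->
  ent f <= \int[P]_x ((f x - c) * expR (f x) - expR (f x) + expR c).
Proof.
move=> bf; rewrite /ent.
rewrite (@E_eq (fun x => (f x - c) * _ - _ + _) (fun x => f x * expR (f x) -
  (c + 1) * expR (f x) + expR c)); last by move=> x; ring.
rewrite ED ?EB ?EZ ?E_cst; try bm; rewrite -expR_lmgf//.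
move: (lmgf f) => a; have := expR_ge1Dx (c - a).
rewrite -(ler_pM2l (expR_gt0 a)) -expRD [a + _]addrC subrK; abstract_integrals; lra.
Qed.

(** The modified logarithmic Sobolev inequality. Only an almost sure lower bound
    [c] is asked, so that an essential infimum can be used. *)
Lemma ent_log_sobolev f (c : R) : bounded_measurable f ->
  {ae P, forall x, c <= f x} ->
  ent f <= 2^-1 * \int[P]_x (Num.max (f x - c) 0 ^+ 2 * expR (f x)).
Proof.
move=> bf cf; apply: (le_trans (ent_le c bf)).
rewrite -EZ; last by bm.
apply: E_ae_le; try bm; apply: filterS cf => x cfx.
rewrite max_l ?subr_ge0//.
have -> : expR c = expR (- (f x - c)) * expR (f x).
  by rewrite -expRD; congr expR; ring.
have h : expR (- (f x - c)) - 1 + (f x - c) <= (f x - c) ^+ 2 / 2.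
  by apply: expRN_le_quad; rewrite subr_ge0.
move: h (expR_gt0 (f x)); set e := expR (- _); set E := expR (f x) => h p.
have : (e - 1 + (f x - c)) * E <= (f x - c) ^+ 2 / 2 * E by rewrite ler_pM2r.
lra.
Qed.

Lemma ent_bennett f (c : R) : bounded_measurable f ->
  0 <= c < 3 -> (forall x, f x <= c) ->
  ent f <= (2 * (1 - c / 3) ^+ 2)^-1 * \int[P]_x (f x ^+ 2).
Proof.
move=> bf c03 fc; apply: (le_trans (ent_le 0 bf)).
rewrite -EZ; last by bm.
apply: E_le; try bm; move=> x; rewrite subr0 expR0.
apply: (le_trans (bennett_quad (fc x) c03)).
by rewrite [leRHS]mulrC [in leRHS]invfM [leRHS]mulrA.
Qed.

Lemma entD f (c : R) : bounded_measurable f ->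
  ent (fun x => f x + c) = expR c * ent f.
Proof.
move=> bf; rewrite /ent.
have e2 : \int[P]_x expR (f x + c) = expR c * \int[P]_x expR (f x).
  by rewrite -EZ; [apply: E_eq => x; rewrite expRD mulrC | bm].
have e1 : \int[P]_x ((f x + c) * expR (f x + c)) =
    expR c * \int[P]_x (f x * expR (f x)) + c * expR c * \int[P]_x expR (f x).
  rewrite -!EZ -?ED; try bm.
  apply: E_eq => x; rewrite expRD; ring.
rewrite e1 e2 {1}/lmgf e2 lnM ?posrE ?expR_gt0 ?E_expR_gt0// expRK -/(lmgf f).
move: (lmgf f); abstract_integrals => l; ring.
Qed.

End expectation.

(** * Variance *)

Section variance.
Context {R : realType} {d : measure_display} {T : measurableType d}
  (P : probability T R).

Lemma E_sqrB (f : T -> R) : bounded_measurable f ->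
  \int[P]_x ((f x - \int[P]_y f y) ^+ 2) =
  \int[P]_x (f x ^+ 2) - (\int[P]_x f x) ^+ 2.
Proof.
move=> bf; set m := \int[P]_y f y.
rewrite (@E_eq _ _ _ _ _ (fun x => f x ^+ 2 - (2 * m) * f x + m ^+ 2)); last first.
  by move=> x; ring.
by rewrite ED ?EB ?EZ ?E_cst; try bm; rewrite -/m; abstract_integrals; ring.
Qed.

(** The variance is half the mean square difference of two independent copies. *)
Lemma variance_half (f : T -> R) (C : R) : bounded_measurable f ->
  (forall x y, (f x - f y) ^+ 2 <= C) ->
  \int[P]_x ((f x - \int[P]_y f y) ^+ 2) <= C / 2.
Proof.
move=> bf fC; rewrite E_sqrB//; set m := \int[P]_x f x.
set q := \int[P]_x (f x ^+ 2).
have h x : f x ^+ 2 - 2 * m * f x + q <= C.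
  have : \int[P]_y ((f x - f y) ^+ 2) <= \int[P]_y C.
    by apply: E_le => //; bm.
  rewrite E_cst (@E_eq _ _ _ _ _ (fun y => f x ^+ 2 - (2 * f x) * f y + f y ^+ 2)).
    rewrite ED ?EB ?EZ ?E_cst; try bm; rewrite -/m -/q; lra.
  by move=> y; ring.
have : \int[P]_x (f x ^+ 2 - 2 * m * f x + q) <= \int[P]_x C.
  by apply: E_le => //; bm.
rewrite ED ?EB ?EZ ?E_cst; try bm; rewrite -/m -/q; lra.
Qed.

(** With centered [U] and [W], the variances on the left are the integrals of
    [U ^+ 2] and of [(U - W) ^+ 2], and the claim follows from
    [0 <= (t * U - W) ^+ 2]. Minimized over [t], the right side is twice the
    product of the standard deviations of [u] and [w]; keeping [t] free avoids
    square roots when such inequalities are summed. *)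
Lemma variance_diff_le (u w : T -> R) (t : R) :
  bounded_measurable u -> bounded_measurable w -> 0 < t ->
  \int[P]_x ((u x - \int[P]_y u y) ^+ 2) -
  \int[P]_x ((u x - w x - \int[P]_y (u y - w y)) ^+ 2) <=
  t * \int[P]_x ((u x - \int[P]_y u y) ^+ 2) +
  t^-1 * \int[P]_x ((w x - \int[P]_y w y) ^+ 2).
Proof.
move=> bu bw t0; rewrite EB//.
move: (\int[P]_y u y) (\int[P]_y w y) => a b.
rewrite -!EZ -?ED -?EB; try bm; apply: E_le; try bm; move=> x.
have -> : u x - w x - (a - b) = (u x - a) - (w x - b) by ring.
move: (u x - a) (w x - b) => U W.
have : 0 <= t^-1 * (t * U - W) ^+ 2 by rewrite mulr_ge0 ?sqr_ge0 ?invr_ge0 ?ltW.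
have -> : t^-1 * (t * U - W) ^+ 2 = t * U ^+ 2 - 2 * (U * W) + t^-1 * W ^+ 2.
  by field; rewrite gt_eqF.
have -> : (U - W) ^+ 2 = U ^+ 2 - 2 * (U * W) + W ^+ 2 by ring.
have := sqr_ge0 W; move: (t * U ^+ 2) (t^-1 * W ^+ 2) => p1 p2.
by move: (U ^+ 2) (W ^+ 2) (U * W) => p3 p4 p5; lra.
Qed.

Lemma variance_bound (u : T -> R) (M : R) : bounded_measurable u ->
  (forall x, `|u x| <= M) -> \int[P]_x ((u x - \int[P]_y u y) ^+ 2) <= (2 * M) ^+ 2.
Proof.
move=> bu uM; rewrite -[leRHS](E_cst P); apply: E_le; try bm; move=> x.
have M0 : 0 <= M := le_trans (normr_ge0 _) (uM x).
rewrite -[leLHS]real_normK ?num_real// lerXn2r ?nnegrE//.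
  by lra.
have := uM x; have := E_norm_le P bu uM; rewrite !ler_norml; lra.
Qed.

End variance.

(** * From entropy bounds to exponential moments *)

(** Below, [h s] stands for the logarithm of the expectation of [expR (s * f)].
    The entropy at [s * f], divided by the expectation of [expR (s * f)], is
    [s * h' s - h s = s ^+ 2 * (h s / s)^`()], so that a bound on the entropy
    limits the growth of [h s / s] from its limit [m], the mean of [f], at 0. *)

Section calculus.
Context {R : realType}.

Lemma is_derive_inv (s : R) : s != 0 -> is_derive s 1 (fun s => s^-1) (- s ^- 2).
Proof.
move=> s0; have := @is_deriveV R id s 1 1 s0 (is_derive_id _ _).
by rewrite /GRing.scale/= mulr1.
Qed.

Variables (h h' : R -> R) (m b : R).
Hypothesis dh : forall s : R, is_derive s 1 h (h' s).
Hypotheses (h0 : h 0 = 0) (h'0 : h' 0 = m) (b0 : 0 < b).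

Lemma small_secant (e : R) : 0 < e ->
  exists s, [/\ 0 < s, s <= b & h s / s <= m + e].
Proof.
move=> e0; have [dh0 hm] := dh 0; rewrite h'0 in hm.
have : (fun s => s^-1 *: ((h \o shift 0) (s *: 1) - h 0)) @ 0^' --> m.
  by rewrite -hm; exact: dh0.
move=> /cvgrPdist_le /(_ e e0) [r /= r0 hr].
pose s := Num.min b (r / 2).
have s0 : 0 < s by rewrite /s lt_min b0/= divr_gt0.
have sr : s < r.
  by rewrite (le_lt_trans (_ : s <= r / 2))// ?/s ?ge_min ?lexx ?orbT//; lra.
exists s; split=> //; first by rewrite /s ge_min lexx.
have : `|m - s^-1 *: (h (s *: 1 + 0) - h 0)| <= e.
  apply: hr => //=; last by rewrite gt_eqF.
  by rewrite sub0r normrN gtr0_norm.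
rewrite h0 subr0 addr0 /GRing.scale/= mulr1 ler_norml => /andP[+ _].
by rewrite [s^-1 * _]mulrC; lra.
Qed.

(** [V / (1 - c * s) ^+ 2] is the derivative of [V * (s / (1 - c * s))]. *)
Lemma herbst_inequality (V c : R) : 0 <= V -> 0 <= c -> c * b < 1 ->
  (forall s : R, 0 < s <= b ->
     s * h' s - h s <= s ^+ 2 / 2 * (V / (1 - c * s) ^+ 2)) ->
  h b <= b * m + b ^+ 2 / 2 * (V / (1 - c * b)).
Proof.
move=> V0 c0 cb1 hh'.
pose K (s : R) := V / 2 * (s / (1 - c * s)) - h s / s.
have mono (e : R) : 0 < e -> e <= b -> K e <= K b.
  move=> e0 eb.
  apply: (@nondecreasing_of_derive _ K (fun s => V / 2 / (1 - c * s) ^+ 2 -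
    (s * h' s - h s) / s ^+ 2) e b eb).
    move=> s es sb.
    have s0 : s != 0 by rewrite gt_eqF//; lra.
    have cs : 1 - c * s != 0.
      rewrite gt_eqF// subr_gt0 (le_lt_trans _ cb1)// ler_wpM2l//.
    have dhs := dh s; have dsV := is_derive_inv s0.
    rewrite /K; apply: is_derive_eq; rewrite /GRing.scale/=.
    field.
    by rewrite s0.
  move=> s es sb; have s0 : 0 < s by lra.
  rewrite subr_ge0 ler_pdivrMr ?exprn_gt0//.
  have /hh' : 0 < s <= b by rewrite s0 ltW.
  move=> /le_trans; apply.
  by rewrite le_eqVlt; apply/orP; left; apply/eqP; ring.
suff : h b / b <= m + V / 2 * (b / (1 - c * b)).
  rewrite ler_pdivrMr// => /le_trans; apply.
  by rewrite le_eqVlt; apply/orP; left; apply/eqP; ring.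
apply/ler_addgt0Pr => e e0.
have [s [s0 sb hs]] := small_secant e0.
have := mono s s0 sb; rewrite /K.
have : 0 <= V / 2 * (s / (1 - c * s)).
  rewrite mulr_ge0 ?divr_ge0// ?(ltW s0)// subr_ge0.
  by rewrite (le_trans _ (ltW cb1))// ler_wpM2l.
move: (h s / s) (h b / b) (V / 2 * (s / _)) (V / 2 * (b / _)) hs => u v w z.
lra.
Qed.

(** The hypothesis says that [h s / s * (1 - a * s / 2)] does not increase. *)
Lemma self_bounded_inequality (a : R) : 0 <= a -> a * b < 2 ->
  (forall s : R, 0 < s -> 0 <= h s) ->
  (forall s : R, 0 < s <= b -> s * h' s - h s <= s ^+ 2 / 2 * a * h' s) ->
  h b <= b * m / (1 - a * b / 2).
Proof.
move=> a0 ab2 hge0 hh'.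
pose K (s : R) := h s * (a / 2) - h s / s.
have mono (e : R) : 0 < e -> e <= b -> K e <= K b.
  move=> e0 eb.
  apply: (@nondecreasing_of_derive _ K (fun s => (s ^+ 2 / 2 * a * h' s -
    (s * h' s - h s)) / s ^+ 2) e b eb).
    move=> s es sb.
    have s0 : s != 0 by rewrite gt_eqF//; lra.
    have dhs := dh s; have dsV := is_derive_inv s0.
    rewrite /K; apply: is_derive_eq; rewrite /GRing.scale/=.
    by field.
  move=> s es sb; have s0 : 0 < s by lra.
  have /hh' : 0 < s <= b by rewrite s0 ltW.
  by rewrite -subr_ge0 => hs; rewrite divr_ge0// exprn_ge0// ltW.
have ab0 : 0 < 1 - a * b / 2 by lra.
rewrite ler_pdivlMr// mulrC -ler_pdivrMl//.
have -> : b^-1 * ((1 - a * b / 2) * h b) = - K b by rewrite /K; field; rewrite gt_eqF.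
apply/ler_addgt0Pr => e e0.
have [s [s0 sb hs]] := small_secant e0.
have hs0 := hge0 s s0.
have := mono s s0 sb; rewrite {1}/K.
have : 0 <= h s * (a / 2) by rewrite mulr_ge0// divr_ge0.
move: (h s / s) (h s * _) (K b) hs => u v w.
lra.
Qed.

End calculus.

Section herbst.
Context {R : realType} {d : measure_display} {T : measurableType d}
  (P : probability T R).
Implicit Types f g : T -> R.

Lemma is_derive_mgf f (b : R) : bounded_measurable f ->
  is_derive b 1 (fun s => \int[P]_x expR (s * f x))
    (\int[P]_x (f x * expR (b * f x))).
Proof.
move=> /[dup] bf /bmP[mf [M hM]].
have M0 : 0 <= M by rewrite (le_trans _ (hM point)).
pose F (s : R) (x : T) := expR (s * f x).
have dF (s : R) x : is_derive s 1 (F^~ x) (f x * expR (s * f x)).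
  by rewrite /F; apply: is_derive_eq; rewrite /GRing.scale/= mulr0 add0r mulr1 mulrC.
have dFE : partial1of2 F = fun s x => f x * expR (s * f x).
  by apply/funext => s; apply/funext => x; rewrite partial1of2E derive_val.
have sb1 (s : R) : b - 1 < s < b + 1 -> `|s| <= `|b| + 1.
  move=> sI; rewrite ler_norml.
  by have := ler_norm b; have := ler_norm (- b); rewrite normrN; lra.
(* dominates the integrand of the derivative on the interval ]b - 1, b + 1[ *)
pose C : R := M * expR ((`|b| + 1) * M).
have bI : [set` `]b - 1, b + 1[ ] b by rewrite /= in_itv/=; lra.
have intF (s : R) : [set` `]b - 1, b + 1[] s -> P.-integrable setT (EFin \o F s).
  by move=> _; apply: bm_integrable; rewrite /F; bm.
have dF1 (s : R) x : [set` `]b - 1, b + 1[] s -> setT x -> derivable (F^~ x) s 1.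
  by move=> _ _; have [] := dF s x.
have C0 (x : T) : 0 <= C by rewrite mulr_ge0// expR_ge0.
have intC : P.-integrable setT (EFin \o (fun=> C)) by apply: bm_integrable; bm.
have dFC (s : R) x : [set` `]b - 1, b + 1[] s -> setT x -> `|partial1of2 F s x| <= C.
  rewrite /= in_itv/= => sI _; rewrite dFE normrM ler_pM//.
  rewrite ger0_norm ?expR_ge0// ler_expR (le_trans (ler_norm _))// normrM ler_pM//.
  exact: sb1.
split.
  exact: (derivable_under_integral measurableT bI intF dF1 C0 intC dFC).
rewrite -derive1E (differentiation_under_integral measurableT bI intF dF1 C0 intC dFC).
by rewrite dFE.
Qed.

Lemma is_derive_lmgf f (b : R) : bounded_measurable f ->
  is_derive b 1 (fun s => lmgf P (fun x => s * f x))
    ((\int[P]_x (f x * expR (b * f x))) / \int[P]_x expR (b * f x)).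
Proof.
move=> bf; rewrite /lmgf.
have Z0 : 0 < \int[P]_x expR (b * f x) by apply: E_expR_gt0; bm.
have := is_derive1_comp (is_derive1_ln Z0) (is_derive_mgf b bf).
by rewrite mulrC.
Qed.

Lemma lmgf0 f : lmgf P (fun x => 0 * f x) = 0.
Proof.
rewrite /lmgf (@E_eq _ _ _ _ _ (fun=> 1)) ?E_cst ?ln1// => x.
by rewrite mul0r expR0.
Qed.

Lemma tilted_mean0 f :
  (\int[P]_x (f x * expR (0 * f x))) / \int[P]_x expR (0 * f x) = \int[P]_x f x.
Proof.
rewrite [X in X / _](@E_eq _ _ _ _ _ f).
  rewrite [X in _ / X](@E_eq _ _ _ _ _ (fun=> 1)) ?E_cst ?divr1// => x.
  by rewrite mul0r expR0.
by move=> x; rewrite mul0r expR0 mulr1.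
Qed.

Lemma ent_lmgf f (s : R) : bounded_measurable f ->
  ent P (fun x => s * f x) = s * (\int[P]_x (f x * expR (s * f x)))
     - (\int[P]_x expR (s * f x)) * lmgf P (fun x => s * f x).
Proof.
move=> bf; rewrite /ent -EZ; last by bm.
by congr (_ - _); apply: E_eq => x; rewrite mulrA.
Qed.

Lemma lmgf_herbst f (V c b : R) : bounded_measurable f ->
  0 <= V -> 0 <= c -> 0 < b -> c * b < 1 ->
  (forall s : R, 0 < s <= b -> ent P (fun x => s * f x) <=
     (\int[P]_x expR (s * f x)) * (s ^+ 2 / 2 * (V / (1 - c * s) ^+ 2))) ->
  lmgf P (fun x => b * f x) <= b * \int[P]_x f x + b ^+ 2 / 2 * (V / (1 - c * b)).
Proof.
move=> bf V0 c0 b0 cb1 hent.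
pose h s := lmgf P (fun x => s * f x).
pose h' s := (\int[P]_x (f x * expR (s * f x))) / \int[P]_x expR (s * f x).
have dh (s : R) : is_derive s 1 h (h' s) by exact: is_derive_lmgf.
have h'0 : h' 0 = \int[P]_x f x by exact: tilted_mean0.
have h0 : h 0 = 0 by exact: lmgf0.
have hh' (s : R) : 0 < s <= b -> s * h' s - h s <= s ^+ 2 / 2 * (V / (1 - c * s) ^+ 2).
  move=> sb; have := hent s sb; rewrite ent_lmgf//.
  have Z0 : 0 < \int[P]_x expR (s * f x) by apply: E_expR_gt0; bm.
  rewrite /h' /h; move: (lmgf _ _) (s ^+ 2 / 2 * _) Z0 => l X.
  set A := \int[P]_x (f x * _); set Z := \int[P]_x _ => Z0 H.
  have -> : s * (A / Z) - l = (s * A - Z * l) / Z by field; rewrite gt_eqF.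
  by rewrite ler_pdivrMr// [leRHS]mulrC.
exact: (herbst_inequality dh).
Qed.

Lemma lmgf_self_bounded g (a b : R) : bounded_measurable g ->
  (forall x, 0 <= g x) -> 0 <= a -> 0 < b -> a * b < 2 ->
  (forall s : R, 0 < s <= b -> ent P (fun x => s * g x) <=
     s ^+ 2 / 2 * a * \int[P]_x (g x * expR (s * g x))) ->
  lmgf P (fun x => b * g x) <= b * (\int[P]_x g x) / (1 - a * b / 2).
Proof.
move=> bf g0 a0 b0 ab2 hent.
pose h s := lmgf P (fun x => s * g x).
pose h' s := (\int[P]_x (g x * expR (s * g x))) / \int[P]_x expR (s * g x).
have dh (s : R) : is_derive s 1 h (h' s) by exact: is_derive_lmgf.
have h'0 : h' 0 = \int[P]_x g x by exact: tilted_mean0.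
have h0 : h 0 = 0 by exact: lmgf0.
have hh' (s : R) : 0 < s <= b -> s * h' s - h s <= s ^+ 2 / 2 * a * h' s.
  move=> sb; have := hent s sb; rewrite ent_lmgf//.
  have Z0 : 0 < \int[P]_x expR (s * g x) by apply: E_expR_gt0; bm.
  rewrite /h' /h.
  move: (lmgf _ _) Z0; abstract_integrals => l Z0 H.
  rewrite mulrA [leRHS]mulrA ler_pdivlMr// mulrBl divfK ?gt_eqF//.
  by rewrite [l * _]mulrC.
apply: (self_bounded_inequality dh) => // s s0.
rewrite /h (le_trans _ (lmgf_ge _ _))//; last by bm.
by apply: E_ge0 => x; rewrite mulr_ge0// ltW.
Qed.

End herbst.

(** * Resampling one coordinate of a product space *)

Section fubini_bounded.
Context {R : realType} {d1 d2 : measure_display}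
  {T1 : measurableType d1} {T2 : measurableType d2}
  (P : probability T1 R) (Q : probability T2 R).

Lemma bm_comp (phi : T1 -> T2) (f : T2 -> R) : measurable_fun setT phi ->
  bounded_measurable f -> bounded_measurable (fun x => f (phi x)).
Proof.
move=> mphi /bmP[mf [M hM]]; apply/bmP; split; last by exists M.
exact: (measurableT_comp mf).
Qed.

Variable F : T1 * T2 -> R.
Hypothesis bF : bounded_measurable F.

Let intF : (P \x Q)%E.-integrable setT (EFin \o F).
Proof. exact: (bm_integrable (P \x Q)%E). Qed.

Lemma bm_section1 x : bounded_measurable (fun y => F (x, y)).
Proof.
by case/bmP: bF => mF [M hM]; apply/bmP; split; [exact: measurableT_comp|exists M].
Qed.

Lemma bm_section2 y : bounded_measurable (fun x => F (x, y)).
Proof.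
by case/bmP: bF => mF [M hM]; apply/bmP; split; [exact: measurableT_comp|exists M].
Qed.

Let intE d (T : measurableType d) (M : probability T R) (f : T -> R) :
  bounded_measurable f -> (\int[M]_x (f x)%:E)%E = (\int[M]_x f x)%:E.
Proof.
move=> bf; rewrite /Rintegral fineK//; apply: integrable_fin_num => //.
exact: bm_integrable.
Qed.

(** Fubini's theorem, for real-valued integrals of bounded functions. *)
Lemma bm_Rintegral : bounded_measurable (fun x => \int[Q]_y F (x, y)).
Proof.
apply/bmP; split; last first.
  have /bmP[mF [M hM]] := bF; exists M => x.
  by apply: E_norm_le => //; exact: bm_section1.
apply/measurable_EFinP.
rewrite (_ : _ \o _ = fubini_F Q (EFin \o F)).
  exact: (measurable_fubini_F intF).
apply/funext => x; rewrite /fubini_F/=.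
by rewrite (intE Q (bm_section1 x)).
Qed.

Lemma Rintegral12 :
  \int[(P \x Q)%E]_z F z = \int[P]_x \int[Q]_y F (x, y).
Proof.
rewrite {1}/Rintegral -(integral12_prod_meas1 intF) [in RHS]/Rintegral.
congr fine; apply: eq_integral => x _; rewrite /fubini_F/=.
by rewrite (intE Q (bm_section1 x)).
Qed.

Lemma Rintegral21 :
  \int[(P \x Q)%E]_z F z = \int[Q]_y \int[P]_x F (x, y).
Proof.
rewrite {1}/Rintegral -(integral21_prod_meas1 intF) [in RHS]/Rintegral.
congr fine; apply: eq_integral => y _; rewrite /fubini_G/=.
by rewrite (intE P (bm_section2 y)).
Qed.

End fubini_bounded.

Section updates.
Context {n : nat} {T : 'I_n -> Type}.
Implicit Types x : forall k, T k.

Lemma dfwith_id x k : dfwith x k (x k) = x.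
Proof. by apply/functional_extensionality_dep => j; case: dfwithP. Qed.

Lemma dfwith_idem x k (y z : T k) : dfwith (dfwith x k y) k z = dfwith x k z.
Proof.
apply/functional_extensionality_dep => j.
by have [<-|kj] := eqVneq k j; rewrite ?dfwithin// !dfwithout.
Qed.

Lemma dfwith_comm x k l (y : T k) (z : T l) : k != l ->
  dfwith (dfwith x k y) l z = dfwith (dfwith x l z) k y.
Proof.
move=> kl; apply/functional_extensionality_dep => j.
have [<-|lj] := eqVneq l j; first by rewrite dfwithin dfwithout// dfwithin.
rewrite dfwithout//; have [<-|kj] := eqVneq k j; first by rewrite !dfwithin.
by rewrite !dfwithout.
Qed.

End updates.

Section product.
Context {R : realType} {n : nat} {d : 'I_n -> measure_display}
  {Omega : forall k, measurableType (d k)}.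
Notation X := (product_space Omega).

Lemma measurable_coord k : measurable_fun setT (fun x : X => x k).
Proof.
move=> _ Y mY; apply: sub_sigma_algebra; exists k => //.
by exists Y.
Qed.

Lemma measurable_to_product d' (S : measurableType d') (h : S -> X) :
  (forall k, measurable_fun setT (fun s => h s k)) -> measurable_fun setT h.
Proof.
move=> mh; apply: (@measurability _ _ S X setT h (cylinders Omega) erefl).
move=> _ [_ [k _ [Y mY <-]] <-]; rewrite !setTI.
by rewrite -[X in measurable X]setTI; exact: (mh k).
Qed.

Lemma measurable_update k :
  measurable_fun setT (fun p : X * Omega k => dfwith p.1 k p.2 : X).
Proof.
apply: measurable_to_product => j.
have [<-|kj] := eqVneq k j.
  by rewrite (_ : (fun _ => _) = snd)//; apply/funext => p; rewrite dfwithin.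
rewrite (_ : (fun _ => _) = (fun x : X => x j) \o fst).
  by apply: (@measurableT_comp _ _ _ _ X) => //; exact: measurable_coord.
by apply/funext => p; rewrite dfwithout.
Qed.

Definition rect (A : forall k, set (Omega k)) : set X :=
  [set x | forall k, A k (x k)].

Definition rects : set (set X) :=
  [set B | exists2 A, (forall k, measurable (A k)) & B = rect A].

Lemma rects_measurable : rects `<=` measurable.
Proof.
move=> _ [A mA ->].
rewrite (_ : rect A = \bigcap_(k in [set: 'I_n]) (fun x : X => x k) @^-1` A k).
  apply: fin_bigcap_measurable => // k _.
  by rewrite -[X in measurable X]setTI; exact: measurable_coord.
by apply/seteqP; split=> x /= h; [move=> k _; exact: h|move=> k; exact: h].
Qed.

Lemma measurable_rects : measurable = <<s rects >>.
Proof.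
apply/seteqP; split; last first.
  apply: smallest_sub; [exact: sigma_algebra_measurable|exact: rects_measurable].
apply: sub_smallest2r => [|]; first exact: smallest_sigma_algebra.
move=> _ [k _ [Y mY <-]]; rewrite setTI.
exists (dfwith (fun j => [set: Omega j]) k Y).
  by move=> j; case: dfwithP.
apply/seteqP; split => x /=.
  by move=> Yx j; case: dfwithP.
by move=> /(_ k); rewrite dfwithin.
Qed.

Lemma rectsI : setI_closed rects.
Proof.
move=> _ _ [A mA ->] [B mB ->]; exists (fun k => A k `&` B k).
  by move=> k; exact: measurableI.
apply/seteqP; split => x /=; first by move=> [hA hB] k; split.
by move=> h; split=> k; have [] := h k.
Qed.

Variable mu_ : forall k, probability (Omega k) R.
Variable mu : probability (product_space Omega) R.
Hypothesis hmu : is_product_measure mu_ mu.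

(** Resampling one coordinate preserves the product measure. Two measures that
    agree on the rectangles are equal, and the preimage of the rectangle with
    sides [B j] is the product of [B k] with the rectangle whose side of index
    [k] has been replaced by the full space. *)
Lemma pushforward_update k (A : set X) : measurable A ->
  mu A = (pushforward (mu \x mu_ k)%E
    (fun p : X * Omega k => dfwith p.1 k p.2 : X) A)%E.
Proof.
move=> mA.
apply: (@measure_unique _ R X rects (fun=> setT) measurable_rects rectsI) => //.
- move=> _; exists (fun=> setT) => //.
  by apply/seteqP; split.
- by apply/seteqP; split => // x _; exists 0%N.
- exact: measurable_update.
- move=> mupd _ [B mB ->].
  have muE A' : (forall j, measurable (A' j)) ->
      mu (rect A') = (\prod_(j < n) mu_ j (A' j))%E by exact: hmu.
  rewrite /= muE//.
  pose B' := dfwith B k [set: Omega k].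
  have mB' j : measurable (B' j) by rewrite /B'; case: dfwithP.
  rewrite /pushforward (_ : _ @^-1` _ = rect B' `*` B k).
    rewrite product_measure1E//; last by apply: rects_measurable; exists B'.
    rewrite [X in _ = (X * _)%E](muE B' mB') (bigD1 k)//=.
    rewrite [in RHS](bigD1 k)//= /B' dfwithin.
    rewrite probability_setT mul1e muleC; congr (_ * _)%E.
    by apply: eq_bigr => j jk; rewrite dfwithout// eq_sym.
  apply/seteqP; split => -[x y] /=.
    move=> h; split; last by have := h k; rewrite dfwithin.
    move=> j; rewrite /B'; case: dfwithP => // j' kj'.
    by have := h j'; rewrite dfwithout.
  move=> [h By] j; case: dfwithP => // j' kj'.
  by have := h j'; rewrite /B' dfwithout.
- by move=> _; rewrite [ltLHS]probability_setT ltry.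
Qed.

Notation E_ := (cond_expectation mu_).

Lemma bm_update k (f : X -> R) : bounded_measurable f ->
  bounded_measurable (fun p : X * Omega k => f (dfwith p.1 k p.2 : X)).
Proof. by move=> bf; apply: (bm_comp _ bf); exact: measurable_update. Qed.

Lemma bm_subst k (y : Omega k) (f : X -> R) : bounded_measurable f ->
  bounded_measurable (subst_op y f).
Proof. by move=> bf; exact: (bm_section2 (bm_update k bf) y). Qed.

Lemma bm_fiber k (x : X) (f : X -> R) : bounded_measurable f ->
  bounded_measurable (fun y : Omega k => f (dfwith x k y)).
Proof. by move=> bf; exact: (bm_section1 (bm_update k bf) x). Qed.

Lemma bm_cond k (f : X -> R) : bounded_measurable f ->
  bounded_measurable (E_ k f).
Proof. by move=> bf; exact: (bm_Rintegral mu (mu_ k) (bm_update k bf)). Qed.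

Lemma E_cond k (f : X -> R) : bounded_measurable f ->
  \int[mu]_x (E_ k f x) = \int[mu]_x f x.
Proof.
move=> bf; have bF := bm_update k bf.
rewrite /cond_expectation /subst_op -(Rintegral12 mu (mu_ k) bF) /Rintegral.
congr fine.
rewrite (eq_measure_integral (pushforward (mu \x mu_ k)%E
   (fun p : X * Omega k => dfwith p.1 k p.2 : X))).
- exact: measurable_update.
- move=> mupd; rewrite integral_pushforward//=.
  + by apply/measurable_EFinP; case: bf.
  + exact: (bm_integrable (mu \x mu_ k)%E bF).
- by move=> mupd A mA _; apply: pushforward_update; exact: mA.
Qed.

Lemma cond_comm k l (f : X -> R) : bounded_measurable f ->
  E_ k (E_ l f) =1 E_ l (E_ k f).
Proof.
move=> bf x; have [->//|kl] := eqVneq k l.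
rewrite /cond_expectation /subst_op.
pose F (p : Omega k * Omega l) := f (dfwith (dfwith x k p.1) l p.2).
have bF : bounded_measurable F.
  apply: (@bm_comp _ _ _ _ X) => //; apply: measurable_to_product => j.
  have [<-|lj] := eqVneq l j.
    by rewrite (_ : (fun _ => _) = snd)//; apply/funext => p; rewrite dfwithin.
  have [kj|kj] := eqVneq k j; last first.
    rewrite (_ : (fun _ => _) = cst (x j))//.
    by apply/funext => p; rewrite !dfwithout.
  rewrite -kj in lj *; rewrite (_ : (fun _ => _) = fst)//.
  by apply/funext => p; rewrite dfwithout// dfwithin.
rewrite -[LHS](Rintegral12 (mu_ k) (mu_ l) bF) (Rintegral21 (mu_ k) (mu_ l) bF).
apply: E_eq => z; apply: E_eq => y.
by rewrite /F/= dfwith_comm.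
Qed.

End product.

(** * Tensorization of entropy *)

Section tensorization.
Context {R : realType} {n : nat} {d : 'I_n -> measure_display}
  {Omega : forall k, measurableType (d k)}.
Notation X := (product_space Omega).
Variable mu_ : forall k, probability (Omega k) R.
Variable mu : probability (product_space Omega) R.
Hypothesis hmu : is_product_measure mu_ mu.
Notation E_ := (cond_expectation mu_).
Implicit Types (f g h u : X -> R) (x : X).

Definition independent_of k f := forall x (y : Omega k), f (dfwith x k y) = f x.

Lemma indep_cond k f : independent_of k (E_ k f).
Proof.
by move=> x y; apply: E_eq => z; rewrite /subst_op dfwith_idem.
Qed.

Lemma indep_condW j k f : independent_of j f -> independent_of j (E_ k f).
Proof.
move=> fj; have [<-|jk] := eqVneq j k; first exact: indep_cond.
by move=> x y; apply: E_eq => z; rewrite /subst_op dfwith_comm.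
Qed.

(** One replaces the coordinates of [x] by those of [x'] one at a time. *)
Lemma indep_cst f : (forall k, independent_of k f) -> forall x x', f x = f x'.
Proof.
move=> fk x x'.
pose w s : X := foldr (fun k (z : X) => dfwith z k (x' k) : X) x s.
have <- : w (enum 'I_n) = x'.
  apply/functional_extensionality_dep => j.
  have : j \in enum 'I_n by rewrite mem_enum.
  rewrite /w; elim: (enum _) => //= k s IH; rewrite inE.
  by have [->|kj] := eqVneq j k; rewrite ?dfwithin//= dfwithout// eq_sym.
by rewrite /w; elim: (enum _) => //= k s ->; rewrite fk.
Qed.

Lemma condM k g f : independent_of k g -> bounded_measurable f ->
  E_ k (fun x => g x * f x) =1 fun x => g x * E_ k f x.
Proof.
move=> gk bf x; rewrite /cond_expectation /subst_op.
by rewrite -EZ; [apply: E_eq => y; rewrite gk | exact: bm_fiber].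
Qed.

Lemma condB k g f : bounded_measurable f -> bounded_measurable g ->
  E_ k (fun x => f x - g x) =1 fun x => E_ k f x - E_ k g x.
Proof.
by move=> bf bg x; rewrite /cond_expectation /subst_op EB//; exact: bm_fiber.
Qed.

Definition cond_lmgf k h : X -> R :=
  fun x => lmgf (mu_ k) (fun y => h (dfwith x k y)).

Arguments cond_lmgf : simpl never.

Definition cond_ent k h : X -> R :=
  fun x => ent (mu_ k) (fun y => h (dfwith x k y)).

Lemma bm_cond_lmgf k h : bounded_measurable h ->
  bounded_measurable (cond_lmgf k h).
Proof.
move=> /[dup] bh /bmP[_ [M hM]].
apply: (@bm_ln _ _ _ (E_ k (fun x => expR (h x))) (expR (- M))).
- exact: expR_gt0.
- move=> x; rewrite -[leLHS](E_cst (mu_ k)); apply: E_le; first by bm.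
    by apply: bm_expR; exact: bm_fiber.
  by move=> y; rewrite ler_expR; have := hM (dfwith x k y); rewrite ler_norml => /andP[].
- by apply: (bm_cond _ mu); bm.
Qed.

Lemma bm_cond_ent k h : bounded_measurable h -> bounded_measurable (cond_ent k h).
Proof.
move=> bh.
have b1 : bounded_measurable (E_ k (fun x => h x * expR (h x))).
  by apply: (bm_cond _ mu); bm.
have b2 : bounded_measurable (E_ k (fun x => expR (h x))).
  by apply: (bm_cond _ mu); bm.
have b3 := bm_cond_lmgf k bh.
rewrite (_ : cond_ent k h = fun x => E_ k (fun x => h x * expR (h x)) x -
  E_ k (fun x => expR (h x)) x * cond_lmgf k h x)//.
by bm.
Qed.

Lemma indep_cond_lmgf k h : independent_of k (cond_lmgf k h).
Proof.
move=> x y; rewrite /cond_lmgf.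
have -> // : (fun z => h (dfwith (dfwith x k y) k z)) = (fun z => h (dfwith x k z)).
by apply/funext => z; rewrite dfwith_idem.
Qed.

Lemma indep_cond_lmgfW j k h : independent_of j h -> independent_of j (cond_lmgf k h).
Proof.
move=> hj; have [<-|jk] := eqVneq j k; first exact: indep_cond_lmgf.
move=> x y; rewrite /cond_lmgf.
have -> // : (fun z => h (dfwith (dfwith x j y) k z)) = (fun z => h (dfwith x k z)).
by apply/funext => z; rewrite dfwith_comm// hj.
Qed.

(** Given the other coordinates, [u - cond_lmgf k u] has a vanishing log-moment
    generating function, so [ent_dv] on the fiber leaves only the entropy. *)
Lemma cond_ent_dv k h u : bounded_measurable h -> bounded_measurable u ->
  \int[mu]_x ((u x - cond_lmgf k u x) * expR (h x)) <= \int[mu]_x cond_ent k h x.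
Proof.
move=> bh bu; have bl := bm_cond_lmgf k bu.
rewrite -(E_cond hmu k); last by bm.
apply: E_le; first by apply: (bm_cond _ mu); bm.
  exact: bm_cond_ent.
move=> x; rewrite /cond_expectation /subst_op.
have bux : bounded_measurable (fun y : Omega k => u (dfwith x k y)) by exact: bm_fiber.
have bhx : bounded_measurable (fun y : Omega k => h (dfwith x k y)) by exact: bm_fiber.
have bvx : bounded_measurable (fun y : Omega k => u (dfwith x k y) - cond_lmgf k u x) by bm.
have := ent_dv (mu_ k) bhx bvx.
rewrite lmgfB// subrr mulr0 addr0; apply: le_trans.
rewrite le_eqVlt; apply/orP; left; apply/eqP; apply: E_eq => y.
by rewrite indep_cond_lmgf.
Qed.

(** Let [H s] be [h] after the operators [cond_lmgf k], [k] in [s], have been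
    applied in turn. Integrating out all coordinates leaves the constant
    [lmgf mu h], so that [ent mu h] is the integral of
    [(h - H (enum 'I_n)) * expR h]. This telescopes into increments which
    [cond_ent_dv] bounds by the conditional entropies. *)
Lemma ent_tensorization h : bounded_measurable h ->
  ent mu h <= \int[mu]_x \sum_(k < n) cond_ent k h x.
Proof.
move=> bh; pose H s := foldr cond_lmgf h s.
have bH s : bounded_measurable (H s).
  by elim: s => //= k s IH; exact: bm_cond_lmgf.
have EH s : \int[mu]_x expR (H s x) = \int[mu]_x expR (h x).
  elim: s => [//|k s <-].
  rewrite -[RHS](E_cond hmu k); last by bm; exact: bH.
  apply: E_eq => x; rewrite -/(H s) /cond_lmgf expR_lmgf//.
  exact: bm_fiber.
have telescope s : \int[mu]_x ((h x - H s x) * expR (h x)) <=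
    \sum_(k <- s) \int[mu]_x cond_ent k h x.
  elim: s => [|k s IH].
    rewrite big_nil (@E_eq _ _ _ _ _ (fun=> 0)) ?E_cst// => x.
    by rewrite subrr mul0r.
  rewrite big_cons (le_trans _ (lerD (cond_ent_dv k bh (bH s)) IH))//.
  have bHs := bH s; have bHks := bm_cond_lmgf k (bH s).
  rewrite -ED; try bm; rewrite le_eqVlt; apply/orP; left; apply/eqP.
  by apply: E_eq => x /=; rewrite -/(H s); ring.
have Hc x : H (enum 'I_n) x = lmgf mu h.
  have Hind j s : j \in s -> independent_of j (H s).
    elim: s => [|k s IH]; first by rewrite in_nil.
    rewrite inE.
    have [-> _|kj js] := eqVneq j k; first exact: indep_cond_lmgf.
    by apply: indep_cond_lmgfW; exact: IH.
  apply: expR_inj; rewrite expR_lmgf// -(EH (enum 'I_n)).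
  rewrite -[LHS](E_cst mu); apply: E_eq => x'; congr expR.
  by apply: indep_cst => j; apply: Hind; rewrite mem_enum.
have := telescope (enum 'I_n).
rewrite big_enum/= -E_sum; last by move=> k; exact: bm_cond_ent.
apply: le_trans; rewrite le_eqVlt; apply/orP; left; apply/eqP.
rewrite (@E_eq _ _ _ _ _ (fun x => h x * expR (h x) - lmgf mu h * expR (h x))).
  by rewrite EB ?EZ; try bm; rewrite /ent mulrC.
by move=> x; rewrite Hc mulrBl.
Qed.

End tensorization.

(** * The reverse Efron-Stein inequality *)

(** The combinatorial part of the reverse Efron-Stein inequality: bounds that
    involve only the pairs in list order add up to half the sum over
    all ordered pairs of distinct indices, by symmetry. *)
Lemma sum_pairs_ge (R : realFieldType) (T : eqType) (Q : T -> R)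
    (W : T -> T -> R) (A : seq T -> R) :
  (forall k l, W k l = W l k) ->
  (forall k s, Q k - (A s - A (k :: s)) <= \sum_(l <- s) W k l) ->
  forall s, uniq s -> 2 * (\sum_(k <- s) Q k - (A [::] - A s)) <=
    \sum_(k <- s) \sum_(l <- s | k != l) W k l.
Proof.
move=> Wsym step; elim=> [|k s IH /= /andP[ks us]].
  by rewrite !big_nil subrr subr0 mulr0.
have {IH} := IH us; rewrite !big_cons eqxx/=.
have -> : \sum_(j <- s) \sum_(l <- (k :: s) | j != l) W j l
   = \sum_(j <- s) W k j + \sum_(j <- s) \sum_(l <- s | j != l) W j l.
  rewrite -big_split/=; apply: eq_big_seq => j js.
  rewrite big_cons ifT; first by rewrite Wsym.
  by apply: contraNneq ks => <-.
have -> : \sum_(l <- s | k != l) W k l = \sum_(l <- s) W k l.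
  rewrite big_seq_cond [RHS]big_seq_cond; apply: eq_bigl => l.
  rewrite andbT; have [ls|//] := boolP (l \in s).
  by apply/negP => /eqP kl; rewrite kl ls in ks.
have := step k s.
move: (\sum_(j <- s) \sum_(l <- s | _) _) (\sum_(i <- s) W _ _) (\sum_(i <- s) Q _).
move: (A _) (A _) (A _) => a1 a2 a3 u v w; lra.
Qed.

Section efron_stein.
Context {R : realType} {n : nat} {d : 'I_n -> measure_display}
  {Omega : forall k, measurableType (d k)}.
Notation X := (product_space Omega).
Variable mu_ : forall k, probability (Omega k) R.
Variable mu : probability (product_space Omega) R.
Hypothesis hmu : is_product_measure mu_ mu.
Notation E_ := (cond_expectation mu_).
Implicit Types (f g h u : X -> R) (x : X).

Let q f := \int[mu]_x (f x ^+ 2).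

Let bmE k f : bounded_measurable f -> bounded_measurable (E_ k f).
Proof. exact: (bm_cond _ mu). Qed.

Definition centered k f : X -> R := fun x => f x - E_ k f x.

Lemma bm_centered k f : bounded_measurable f -> bounded_measurable (centered k f).
Proof. by move=> bf; have := bmE k bf; rewrite /centered => ?; bm. Qed.

(** [E_ k] is an orthogonal projection of L2. *)
Lemma pythagoras k f : bounded_measurable f ->
  q (centered k f) = q f - q (E_ k f).
Proof.
move=> bf; have bEf := bmE k bf.
have cross : \int[mu]_x (E_ k f x * f x) = q (E_ k f).
  rewrite -(E_cond hmu k); last by bm.
  by apply: E_eq => x; rewrite condM//; exact: indep_cond.
rewrite /q /centered (@E_eq _ _ _ _ _ (fun x => f x ^+ 2 -
  2 * (E_ k f x * f x) + E_ k f x ^+ 2)); last by move=> x; ring.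
rewrite ED ?EB ?EZ; try bm; rewrite cross /q; abstract_integrals; ring.
Qed.

Lemma cond_contraction k f : bounded_measurable f -> q (E_ k f) <= q f.
Proof.
move=> bf; rewrite -subr_ge0 -pythagoras//; apply: E_ge0 => x.
exact: sqr_ge0.
Qed.

Definition cond_seq (s : seq 'I_n) f : X -> R := foldr (fun k g => E_ k g) f s.

Lemma bm_cond_seq s f : bounded_measurable f -> bounded_measurable (cond_seq s f).
Proof. by move=> bf; elim: s => [//|k s IH]; exact: bmE. Qed.

Lemma cond_seq_contraction s f : bounded_measurable f -> q (cond_seq s f) <= q f.
Proof.
move=> bf; elim: s => [//|k s IH].
by apply: le_trans IH; apply: cond_contraction; exact: bm_cond_seq.
Qed.

Lemma cond_seq_centered s k f : bounded_measurable f ->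
  cond_seq s (centered k f) = centered k (cond_seq s f).
Proof.
move=> bf; elim: s => [//|l s IH].
have bA := bm_cond_seq s bf.
transitivity (E_ l (centered k (cond_seq s f))); first by rewrite -IH.
apply/funext => x; rewrite /centered -/(E_ k (cond_seq s f)).
rewrite (condB mu_ l bA (bmE k bA)).
by rewrite (cond_comm mu_ l k bA).
Qed.

(** The Efron-Stein inequality for the coordinates in [s]. Since the [E_ k] are
    commuting projections, each increment of the left side is the squared norm of
    [cond_seq s (centered k f)], and [cond_seq s] is a contraction. *)
Lemma efron_stein_seq s f : bounded_measurable f ->
  q f - q (cond_seq s f) <= \sum_(k <- s) q (centered k f).
Proof.
move=> bf; elim: s => [|k s IH]; first by rewrite big_nil subrr.
rewrite big_cons.
have bA := bm_cond_seq s bf.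
have h1 : q (cond_seq s f) - q (E_ k (cond_seq s f)) <= q (centered k f).
  rewrite -pythagoras// -cond_seq_centered//.
  by apply: cond_seq_contraction; exact: bm_centered.
move: IH h1; rewrite [cond_seq (k :: s) f]/(E_ k (cond_seq s f)).
by move: (q _) (q _) (q _) (q _) => q1 q2 q3 q4; lra.
Qed.

Lemma centered_comm k l f : bounded_measurable f ->
  centered k (centered l f) = centered l (centered k f).
Proof.
move=> bf; have bk := bmE k bf; have bl := bmE l bf.
apply/funext => x; rewrite /centered !condB// (cond_comm mu_ l k bf); ring.
Qed.

(** When [k] is integrated out after [s], the variance of [f] accounts for
    [q (cond_seq s (centered k f))] only, instead of [q (centered k f)]. The
    loss is the variance of [centered k f] in the coordinates of [s], which the
    Efron-Stein inequality bounds. *)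
Lemma reverse_efron_stein_seq s f : bounded_measurable f -> uniq s ->
  2 * (\sum_(k <- s) q (centered k f) - (q f - q (cond_seq s f))) <=
  \sum_(k <- s) \sum_(l <- s | k != l) q (centered l (centered k f)).
Proof.
move=> bf; apply: (@sum_pairs_ge _ _ (fun k => q (centered k f))
  (fun k l => q (centered l (centered k f))) (fun s => q (cond_seq s f))).
  by move=> k l; rewrite centered_comm.
move=> k {}s; have := efron_stein_seq s (bm_centered k bf).
by rewrite cond_seq_centered// [q (centered k (cond_seq s f))]pythagoras//; exact: bm_cond_seq.
Qed.

Lemma E_cond_variance k f : bounded_measurable f ->
  \int[mu]_x cond_variance mu_ k f x = q (centered k f).
Proof.
move=> bf; rewrite /cond_variance (E_cond hmu)//.
by apply: bmX; exact: bm_centered.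
Qed.

(** Having integrated out every coordinate one is left with the mean. *)
Lemma cond_seq_enum f x : bounded_measurable f ->
  cond_seq (enum 'I_n) f x = \int[mu]_x f x.
Proof.
move=> bf.
have Eseq s : \int[mu]_x cond_seq s f x = \int[mu]_x f x.
  elim: s => [//|k s <-]; rewrite -[RHS](E_cond hmu k)//; exact: bm_cond_seq.
have ind j s : j \in s -> independent_of j (cond_seq s f).
  elim: s => [//|k s IH]; rewrite inE.
  have [-> _|kj js] := eqVneq j k; first exact: indep_cond.
  by apply: indep_condW; exact: IH.
rewrite -(Eseq (enum 'I_n)) -[LHS](E_cst mu); apply: E_eq => x'.
by apply: indep_cst => j; apply: ind; rewrite mem_enum.
Qed.

(** The sum of the conditional variances exceeds the variance by an amount that
    only the interactions of pairs of coordinates contribute to. *)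
Lemma reverse_efron_stein f : bounded_measurable f ->
  2 * (\int[mu]_x (\sum_(k < n) cond_variance mu_ k f x)
       - \int[mu]_x ((f x - \int[mu]_x f x) ^+ 2)) <=
  \int[mu]_x \sum_(k < n) \sum_(l < n | k != l) cond_variance mu_ l (centered k f) x.
Proof.
move=> bf.
have bV k g : bounded_measurable g -> bounded_measurable (cond_variance mu_ k g).
  by move=> bg; apply: bmE; apply: bmX; exact: bm_centered.
have := reverse_efron_stein_seq bf (enum_uniq 'I_n).
have -> : q (cond_seq (enum 'I_n) f) = (\int[mu]_x f x) ^+ 2.
  rewrite /q -[RHS](E_cst mu); apply: E_eq => x.
  by rewrite cond_seq_enum.
have -> : \sum_(k <- enum 'I_n) q (centered k f) =
    \int[mu]_x (\sum_(k < n) cond_variance mu_ k f x).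
  rewrite big_enum E_sum; last by move=> k; exact: bV.
  by apply: eq_bigr => k _; rewrite E_cond_variance.
have -> : \sum_(k <- enum 'I_n) \sum_(l <- enum 'I_n | k != l)
      q (centered l (centered k f)) =
    \int[mu]_x \sum_(k < n) \sum_(l < n | k != l)
      cond_variance mu_ l (centered k f) x.
  have bc k := bm_centered k bf.
  rewrite big_enum E_sum; last by move=> k; apply: bm_sum => l; exact: bV.
  apply: eq_bigr => k _; rewrite big_enum_cond E_sum; last by move=> l; exact: bV.
  by apply: eq_bigr => l _; rewrite E_cond_variance.
by rewrite E_sqrB.
Qed.

(** The increments of [centered k f] in coordinate [l] are averages, over a
    fresh copy of coordinate [k], of the mixed second differences of [f];
    [variance_half] then gives the factor 1/2. *)
Lemma cond_variance_centered_le k l f x (C : R) : k != l -> bounded_measurable f ->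
  (forall (z z' : Omega l) (y y' : Omega k),
    (diff_op z z' (diff_op y y' f) x) ^+ 2 <= C) ->
  cond_variance mu_ l (centered k f) x <= C / 2.
Proof.
move=> kl bf hC; rewrite /cond_variance {1}/cond_expectation /subst_op.
have bg := bm_centered k bf.
rewrite (@E_eq _ _ _ _ _ (fun z => (centered k f (dfwith x l z) -
   \int[mu_ l]_y centered k f (dfwith x l y)) ^+ 2)); last first.
  by move=> z; rewrite (indep_cond mu_ (centered k f)).
apply: variance_half; first exact: bm_fiber.
move=> z z'.
have C0 : 0 <= C by apply: le_trans (hC z z (x k) (x k)); exact: sqr_ge0.
suff : `|centered k f (dfwith x l z) - centered k f (dfwith x l z')| <= Num.sqrt C.
  move=> h; rewrite -[leRHS]sqr_sqrtr// -[leLHS]real_normK ?num_real//.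
  by rewrite lerXn2r// ?nnegrE// sqrtr_ge0.
pose D (y : Omega k) := f (dfwith x l z) - f (dfwith (dfwith x l z) k y)
   - (f (dfwith x l z') - f (dfwith (dfwith x l z') k y)).
have bD : bounded_measurable D.
  by rewrite /D; bm; exact: bm_fiber.
have -> : centered k f (dfwith x l z) - centered k f (dfwith x l z') = \int[mu_ k]_y D y.
  rewrite /D !EB ?E_cst; try bm; try exact: bm_fiber.
  by rewrite /centered /cond_expectation /subst_op.
apply: E_norm_le => // y.
have := hC z z' (x k) y; rewrite /diff_op /subst_op/=.
have upd_k (w : Omega l) : dfwith (dfwith x l w) k (x k) = dfwith x l w.
  by rewrite -[X in dfwith _ k X](dfwithout _ w) 1?eq_sym// dfwith_id.
by rewrite !upd_k -/(D y) => h; rewrite -sqrtr_sqr ler_wsqrtr.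
Qed.

Lemma interaction_bound f x : bounded_measurable f ->
  \sum_(k < n) \sum_(l < n | k != l) cond_variance mu_ l (centered k f) x
   <= interaction f ^+ 2 / 2.
Proof.
move=> /[dup] bf /bmP[_ [M hM]].
pose DD x k l (z z' : Omega l) (y y' : Omega k) := (diff_op z z' (diff_op y y' f) x) ^+ 2.
pose S1 x k l z z' := [set DD x k l z z' y y' | y in [set: Omega k] & y' in [set: Omega k]].
pose S2 x k l := [set sup (S1 x k l z z') | z in [set: Omega l] & z' in [set: Omega l]].
have DDM x' k l z z' y y' : DD x' k l z z' y y' <= (4 * M) ^+ 2.
  rewrite /DD -[leLHS]real_normK ?num_real// lerXn2r ?nnegrE//.
    by have := hM x; have := normr_ge0 (f x); lra.
  have sum4 (a b c e : R) : `|a| <= M -> `|b| <= M -> `|c| <= M -> `|e| <= M ->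
      `|a - b - (c - e)| <= 4 * M.
    by rewrite !ler_norml; lra.
  by rewrite /diff_op /subst_op/=; apply: sum4; exact: hM.
have ub1 x' k l z z' : has_ubound (S1 x' k l z z').
  by exists ((4 * M) ^+ 2) => _ [y _ [y' _ <-]]; exact: DDM.
have s1M x' k l z z' : sup (S1 x' k l z z') <= (4 * M) ^+ 2.
  apply: ge_sup; last by move=> _ [y _ [y' _ <-]]; exact: DDM.
  by exists (DD x' k l z z' (x' k) (x' k)), (x' k) => //; exists (x' k).
have ub2 x' k l : has_ubound (S2 x' k l).
  by exists ((4 * M) ^+ 2) => _ [z _ [z' _ <-]]; exact: s1M.
have s2M x' k l : sup (S2 x' k l) <= (4 * M) ^+ 2.
  apply: ge_sup; last by move=> _ [z _ [z' _ <-]]; exact: s1M.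
  by exists (sup (S1 x' k l (x' l) (x' l))), (x' l) => //; exists (x' l).
have DDs x' k l z z' y y' : DD x' k l z z' y y' <= sup (S2 x' k l).
  apply: (@le_trans _ _ (sup (S1 x' k l z z'))); apply: ub_le_sup => //.
    by exists y => //; exists y'.
  by exists z => //; exists z'.
pose B x := \sum_(k < n) \sum_(l < n | k != l) sup (S2 x k l).
have B0 x' : 0 <= B x'.
  rewrite sumr_ge0// => k _; rewrite sumr_ge0// => l _.
  by apply: le_trans (DDs x' k l (x' l) (x' l) (x' k) (x' k)); exact: sqr_ge0.
have Bsup : B x <= sup [set B x | x in [set: X]].
  apply: ub_le_sup; last by exists x.
  exists (\sum_(k < n) \sum_(l < n | k != l) (4 * M) ^+ 2) => _ [x' _ <-].
  by apply: ler_sum => k _; apply: ler_sum => l _.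
rewrite /interaction sqr_sqrtr; last exact: le_trans Bsup.
apply: (@le_trans _ _ (B x / 2)); last by rewrite ler_pM2r.
rewrite /B big_distrl/=; apply: ler_sum => k _.
rewrite big_distrl/=; apply: ler_sum => l kl.
by apply: cond_variance_centered_le => // z z' y y'; exact: DDs.
Qed.

End efron_stein.

(** * Essential infimum along one coordinate *)

Section ess_inf.
Context {R : realType} {n : nat} {d : 'I_n -> measure_display}
  {Omega : forall k, measurableType (d k)}.
Notation X := (product_space Omega).
Variable mu_ : forall k, probability (Omega k) R.
Variables (k : 'I_n) (g : X -> R).
Hypotheses (bg : bounded_measurable g) (g0 : forall x, 0 <= g x).

Let below (r : R) (x : X) : set (Omega k) := [set y | g (dfwith x k y) < r].

Let null (r : R) : set X := [set x | mu_ k (below r x) = 0%E].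

Let q_ (N : nat) : R := ratr (odflt 0 (unpickle N)).

Let u (N : nat) (x : X) : R := q_ N * \1_(null (q_ N)) x.

(** The infimum over a coordinate need not be measurable, while this supremum over
    the rationals [r] such that [g < r] is a null event on the fiber is. The
    indicator contributes 0 for the other rationals, which is harmless as [g] is
    nonnegative. *)
Definition cond_ess_inf (x : X) : R := sups (u^~ x) 0.

Let measurable_below r x : measurable (below r x).
Proof.
have [mf _] := bm_fiber k x bg.
rewrite /below -[X in measurable X]setTI.
exact: (measurable_fun_ltr mf (measurable_cst r)) measurableT [set true] _.
Qed.

Let measurable_null r : measurable (null r).
Proof.
have [mF _] := bm_update k bg.
pose A : set (X * Omega k) := [set p | g (dfwith p.1 k p.2) < r].
have mA : measurable A.
  rewrite -[X in measurable X]setTI.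
  exact: (measurable_fun_ltr mF (measurable_cst r)) measurableT [set true] _.
have := measurable_fun_xsection (mu_ k) mA measurableT (emeasurable_set1 0%E).
rewrite setTI; congr measurable; apply/seteqP; split => x /=;
  by rewrite /null/= /below /A xsectionE.
Qed.

Let u_le M x N : (forall x, g x <= M) -> u N x <= M.
Proof.
move=> gM; have M0 : 0 <= M := le_trans (g0 x) (gM x).
rewrite /u indicE; case: (boolP (x \in _)) => [|_]; last by rewrite mulr0.
rewrite inE mulr1 /null/= => h; rewrite leNgt; apply/negP => Mq.
move: h; rewrite (_ : below _ _ = setT).
  by rewrite probability_setT => /eqP; rewrite onee_eq0.
by apply/seteqP; split => y //= _; rewrite /below/= (le_lt_trans (gM _)).
Qed.

Let u_ubound x : has_ubound (range (u^~ x)).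
Proof.
have /bmP[_ [M hM]] := bg; exists M => _ [N _ <-]; apply: u_le => y.
exact: le_trans (ler_norm _) (hM y).
Qed.

Let u_le_inf N x : u N x <= cond_ess_inf x.
Proof. by apply: ub_le_sup; [exact: has_ubound_sdrop|exists N]. Qed.

Lemma cond_ess_inf_ge x c : (forall y, c <= g (dfwith x k y)) -> c <= cond_ess_inf x.
Proof.
move=> cg; rewrite leNgt; apply/negP => /rat_in_itvoo[r].
rewrite in_itv/= => /andP[infr rc].
have := u_le_inf (pickle r) x; rewrite /u /q_ pickleK/= indicE.
rewrite mem_set ?mulr1; first by rewrite leNgt infr.
rewrite /null/= (_ : below _ _ = set0) ?measure0//.
apply/seteqP; split => y //=; rewrite /below/= => h.
by have := lt_trans (le_lt_trans (cg y) h) rc; rewrite ltxx.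
Qed.

Lemma cond_ess_inf_ae x : {ae mu_ k, forall y, cond_ess_inf x <= g (dfwith x k y)}.
Proof.
have : {ae mu_ k, forall y, forall N, u N x <= g (dfwith x k y)}.
  apply: ae_foralln => N; rewrite /u indicE.
  case: (boolP (x \in _)) => [|_]; last by apply: aeW => y; rewrite mulr0.
  rewrite inE mulr1 => xN; exists (below (q_ N) x); split => //.
  by move=> y /=; rewrite /below/= => /negP; rewrite -ltNge.
apply: filterS => y uy; apply: ge_sup; first by exists (u 0 x), 0%N.
by move=> _ [N _ <-].
Qed.

Lemma bm_cond_ess_inf : bounded_measurable cond_ess_inf.
Proof.
have /bmP[_ [M hM]] := bg; apply/bmP; split.
  apply: measurable_fun_sups => [x _|N]; first exact: u_ubound.
  by apply: measurable_funM => //; exact: measurable_indic.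
exists M => x; have gM y : g y <= M := le_trans (ler_norm _) (hM y).
rewrite ger0_norm; last exact: cond_ess_inf_ge.
apply: ge_sup; first by exists (u 0 x), 0%N.
by move=> _ [N _ <-]; exact: u_le.
Qed.

Lemma indep_cond_ess_inf : independent_of k cond_ess_inf.
Proof.
move=> x y; rewrite /cond_ess_inf; congr (sups _ _); apply/funext => N.
rewrite /u !indicE; congr (_ * (_ : bool)%:R).
apply/idP/idP; rewrite !inE /null/=;
  by rewrite (_ : below _ (dfwith x k y) = below (q_ N) x)//;
     apply/funext => z; rewrite /below/= dfwith_idem.
Qed.

End ess_inf.

(** * The sum of the conditional variances is self-bounding *)

(** The hypothesis at the best [t] reads [D <= 2 * sqrt (g * B)]. *)
Lemma sqr_max_le (R : realFieldType) (D g B : R) : 0 <= g -> 0 <= B ->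
  (forall t, 0 < t -> D <= t * g + t^-1 * B) -> Num.max D 0 ^+ 2 <= 4 * g * B.
Proof.
move=> g0 B0 H; have [D0|D0] := leP D 0.
  by rewrite expr0n/= !mulr_ge0.
move: g0; rewrite le_eqVlt => /predU1P[g0|g0].
  have B1 : 0 < B + 1 by lra.
  (* [g = 0]: any [t > B / D] contradicts [0 < D] *)
  have := H ((B + 1) / D) (divr_gt0 B1 D0).
  rewrite -g0 mulr0 add0r invf_div mulrAC ler_pdivlMr//; nra.
have := H (D / (2 * g)) (divr_gt0 D0 (mulr_gt0 _ g0)).
rewrite ltr0n invf_div => /(_ isT).
have -> : D / (2 * g) * g + 2 * g / D * B = D / 2 + 2 * g * B / D.
  by field; rewrite !gt_eqF.
rewrite -lerBlDl ler_pdivlMr//; nra.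
Qed.

Section self_bounding.
Context {R : realType} {n : nat} {d : 'I_n -> measure_display}
  {Omega : forall k, measurableType (d k)}.
Notation X := (product_space Omega).
Variable mu_ : forall k, probability (Omega k) R.
Variable mu : probability (product_space Omega) R.
Hypothesis hmu : is_product_measure mu_ mu.
Notation E_ := (cond_expectation mu_).
Notation V_ := (cond_variance mu_).
Implicit Types (f g h u : X -> R) (x : X).

Lemma cond_varianceE k f x :
  V_ k f x = \int[mu_ k]_y ((f (dfwith x k y) -
    \int[mu_ k]_z f (dfwith x k z)) ^+ 2).
Proof.
rewrite /cond_variance {1}/cond_expectation; apply: E_eq => y.
by rewrite {1}/subst_op (indep_cond mu_ f).
Qed.

Lemma cond_variance_ge0 k f x : 0 <= V_ k f x.
Proof. by apply: E_ge0 => y; rewrite /subst_op sqr_ge0. Qed.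

Lemma bm_cond_variance k f : bounded_measurable f -> bounded_measurable (V_ k f).
Proof.
by move=> bf; apply: (bm_cond _ mu); apply: bmX; exact: (bm_centered _ mu).
Qed.

Lemma cond_variance_subst k l f x (z : Omega l) : k != l ->
  V_ k f (dfwith x l z) = V_ k (subst_op z f) x.
Proof.
move=> kl; rewrite !cond_varianceE /subst_op.
have upd y : f (dfwith (dfwith x l z) k y) = f (dfwith (dfwith x k y) l z).
  by rewrite dfwith_comm// eq_sym.
rewrite (@E_eq _ _ _ (mu_ k) (fun y => f (dfwith (dfwith x l z) k y))
  (fun y => f (dfwith (dfwith x k y) l z)))//.
by apply: E_eq => y; rewrite upd.
Qed.

Lemma cond_variance_diff_le k f h x (t : R) :
  bounded_measurable f -> bounded_measurable h -> 0 < t ->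
  V_ k f x - V_ k h x <= t * V_ k f x + t^-1 * V_ k (f \- h) x.
Proof.
move=> bf bh t0; rewrite !cond_varianceE.
have bfx := bm_fiber k x bf; have bhx := bm_fiber k x bh.
have e y : h (dfwith x k y) =
    f (dfwith x k y) + - (f (dfwith x k y) + - h (dfwith x k y)) by ring.
rewrite [X in _ - X <= _](@E_eq _ _ _ _ _ (fun y =>
  (f (dfwith x k y) - (f (dfwith x k y) - h (dfwith x k y)) -
   \int[mu_ k]_z (f (dfwith x k z) -
     (f (dfwith x k z) - h (dfwith x k z)))) ^+ 2)).
  exact: (variance_diff_le (mu_ k) bfx (bmD bfx (bmN bhx)) t0).
by move=> y; congr (_ ^+ 2); congr (_ - _); [exact: e | apply: E_eq => z; exact: e].
Qed.

Definition variance_sum f : X -> R := fun x => \sum_(k < n) V_ k f x.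

Lemma bm_variance_sum f : bounded_measurable f -> bounded_measurable (variance_sum f).
Proof. by move=> bf; apply: bm_sum => k; exact: bm_cond_variance. Qed.

Lemma variance_sum_ge0 f x : 0 <= variance_sum f x.
Proof. by apply: sumr_ge0 => k _; exact: cond_variance_ge0. Qed.

Let B f l x (z : Omega l) := \sum_(k < n | k != l) V_ k (f \- subst_op z f) x.
Let Bsup f l x := sup [set B f x z | z in [set: Omega l]].

(** The conditional variance of index [l] does not depend on the coordinate
    [z] that is replaced, hence drops out of the difference. *)
Lemma variance_sum_diff_le f x l (z : Omega l) (t : R) :
  bounded_measurable f -> 0 < t ->
  variance_sum f x - variance_sum f (dfwith x l z) <=
  t * variance_sum f x + t^-1 * B f x z.
Proof.
move=> bf t0.
have split_l x' : variance_sum f x' = V_ l f x' + \sum_(k < n | k != l) V_ k f x'.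
  by rewrite /variance_sum (bigD1 l).
rewrite !split_l [V_ l f (dfwith x l z)](indep_cond mu_ (fun x => (f x - E_ l f x) ^+ 2) x z).
rewrite -/(V_ l f) opprD addrACA subrr add0r -sumrB.
have VD k : k != l -> V_ k f x - V_ k f (dfwith x l z) <=
    t * V_ k f x + t^-1 * V_ k (f \- subst_op z f) x.
  move=> kl; rewrite cond_variance_subst//.
  by apply: cond_variance_diff_le => //; exact: bm_subst.
apply: (le_trans (ler_sum _ VD)).
rewrite /B big_split/= -[X in _ + X <= _]mulr_sumr -[X in X + _ <= _]mulr_sumr.
apply: lerD; last exact: lexx.
by apply: ler_wpM2l; [exact: ltW|rewrite lerDr; exact: cond_variance_ge0].
Qed.

Section bounds.
Variables (f : X -> R).
Hypothesis bf : bounded_measurable f.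

Let B_bound : exists M, forall l x z, @B f l x z <= M.
Proof.
have /bmP[_ [M hM]] := bf.
exists (\sum_(k < n) (2 * (M + M)) ^+ 2) => l x z.
rewrite /B big_mkcond/=; apply: ler_sum => k _.
case: ifP => _; last exact: sqr_ge0.
rewrite cond_varianceE; apply: variance_bound.
  exact: (bm_fiber k x (bmD bf (bmN (bm_subst z bf)))).
move=> y; apply: (le_trans (ler_normB _ _)).
by apply: lerD; [exact: hM|exact: (hM (dfwith _ l z))].
Qed.

Let B_ge0 l x z : 0 <= @B f l x z.
Proof. by apply: sumr_ge0 => k _; exact: cond_variance_ge0. Qed.

Let B_le_sup l x z : @B f l x z <= Bsup f l x.
Proof.
have [M hM] := B_bound; apply: ub_le_sup; last by exists z.
by exists M => _ [z' _ <-].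
Qed.

Let Bsup_ge0 l x : 0 <= Bsup f l x.
Proof. exact: le_trans (B_ge0 x (x l)) (B_le_sup _ _). Qed.

Let Bsup_interaction x : 4 * \sum_(l < n) Bsup f l x <= interaction_mu mu_ f ^+ 2.
Proof.
have [M hM] := B_bound.
have le_sup : \sum_(l < n) Bsup f l x <= sup [set \sum_(l < n) Bsup f l x | x in [set: X]].
  apply: ub_le_sup; last by exists x.
  exists (\sum_(l < n) M) => _ [x' _ <-]; apply: ler_sum => l _.
  apply: ge_sup; last by move=> _ [z _ <-].
  by exists (B f x' (x' l)), (x' l).
rewrite /interaction_mu exprMn sqr_sqrtr.
  by rewrite (_ : 2 ^+ 2 = 4 :> R) ?ler_pM2l//; ring.
by apply: le_trans le_sup; apply: sumr_ge0.
Qed.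

Let g := variance_sum f.
Let m l := cond_ess_inf mu_ l g.

Let bg : bounded_measurable g. Proof. exact: bm_variance_sum. Qed.
Let g0 x : 0 <= g x. Proof. exact: variance_sum_ge0. Qed.

(** [variance_sum_diff_le] bounds [g x] minus a lower bound of [g] on the fiber
    through [x], and the essential infimum [m l x] is above every such bound.
    Optimizing over [t], then summing over [l], makes the square of
    [interaction_mu] appear. *)
Lemma variance_sum_self_bounding x :
  \sum_(l < n) Num.max (g x - m l x) 0 ^+ 2 <= interaction_mu mu_ f ^+ 2 * g x.
Proof.
have term l : Num.max (g x - m l x) 0 ^+ 2 <= 4 * g x * Bsup f l x.
  apply: sqr_max_le => // t t0; rewrite lerBlDl -lerBlDr.
  apply: (cond_ess_inf_ge mu_ bg g0) => z.
  rewrite lerBlDr -lerBlDl; apply: le_trans (variance_sum_diff_le x z bf t0) _.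
  by rewrite lerD2l ler_pM2l ?invr_gt0.
apply: (le_trans (ler_sum _ (fun l _ => term l))).
rewrite -mulr_sumr (_ : 4 * g x * _ = 4 * (\sum_(l < n) Bsup f l x) * g x); last by ring.
by rewrite ler_wpM2r.
Qed.

(** Tensorization, and on each fiber the modified logarithmic Sobolev inequality
    with the essential infimum as lower bound. *)
Lemma ent_variance_sum s : 0 < s ->
  ent mu (fun x => s * g x) <=
  s ^+ 2 / 2 * interaction_mu mu_ f ^+ 2 * \int[mu]_x (g x * expR (s * g x)).
Proof.
move=> s0; have bm_m l : bounded_measurable (m l) by exact: bm_cond_ess_inf.
have bsg : bounded_measurable (fun x => s * g x) by bm.
apply: (le_trans (ent_tensorization hmu bsg)).
pose F l x := Num.max (s * g x - s * m l x) 0 ^+ 2 * expR (s * g x).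
have bF l : bounded_measurable (F l) by have := bm_m l; rewrite /F => ?; bm.
have entF l x : cond_ent mu_ l (fun x => s * g x) x <= 2^-1 * E_ l (F l) x.
  have bfib := bm_fiber l x bsg.
  apply: (le_trans (@ent_log_sobolev _ _ _ (mu_ l) _ (s * m l x) bfib _)).
    have := cond_ess_inf_ae mu_ l bg g0 x; apply: filterS => y my.
    by rewrite ler_pM2l.
  apply: ler_wpM2l; first by rewrite invr_ge0.
  rewrite le_eqVlt; apply/orP; left; apply/eqP.
  apply: E_eq => y; rewrite /subst_op /F.
  by rewrite [m l (dfwith x l y)](indep_cond_ess_inf mu_ g x y).
apply: (@le_trans _ _ (\int[mu]_x (\sum_(l < n) 2^-1 * E_ l (F l) x))).
  apply: E_le.
  - by apply: bm_sum => l; exact: (bm_cond_ent mu_ mu).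
  - by apply: bm_sum => l; apply: bmM; [exact: bm_cst|exact: (bm_cond _ mu)].
  - by move=> x; apply: ler_sum => l _; exact: entF.
rewrite E_sum; last first.
  by move=> l; apply: bmM; [exact: bm_cst|exact: (bm_cond _ mu)].
have -> : \sum_(l < n) \int[mu]_x (2^-1 * E_ l (F l) x) =
    \int[mu]_x (2^-1 * \sum_(l < n) F l x).
  rewrite EZ; last exact: bm_sum.
  rewrite E_sum// mulr_sumr; apply: eq_bigr => l _.
  by rewrite EZ; [rewrite (E_cond hmu)|exact: (bm_cond _ mu)].
rewrite -EZ; last by bm.
apply: E_le; first by apply: bmM; [exact: bm_cst|exact: bm_sum].
  by bm.
move=> x.
have FE l : F l x = s ^+ 2 * expR (s * g x) * Num.max (g x - m l x) 0 ^+ 2.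
  rewrite /F -mulrBr -[0 in LHS](mulr0 s) -maxr_pMr; last exact: ltW.
  by rewrite exprMn mulrAC.
rewrite (eq_bigr _ (fun l _ => FE l)) -mulr_sumr.
have -> : s ^+ 2 / 2 * interaction_mu mu_ f ^+ 2 * (g x * expR (s * g x)) =
    2^-1 * (s ^+ 2 * expR (s * g x) * (interaction_mu mu_ f ^+ 2 * g x)).
  by ring.
rewrite ler_pM2l ?invr_gt0// ler_pM2l ?mulr_gt0 ?expR_gt0 ?exprn_gt0//.
exact: variance_sum_self_bounding.
Qed.

End bounds.
End self_bounding.

(** * The Bernstein inequality *)

(** [S] is the entropy at [s * f], [Z] the normalization, [G] the integral of the
    sum of conditional variances against [expR (s * f)], and the second bound is
    [ent_dv] at [t] times that sum. The best [t] is [r / a]; then [S] occurs on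
    both sides, on the right with the factor [a * r / 2 < 1]. When [a = 0] there
    is no best [t], and one lets it tend to infinity. *)
Lemma decoupled_entropy_bound (R : realFieldType) (S G Z V a r : R) :
  0 <= S -> 0 < Z -> 0 <= V -> 0 <= a -> 0 < r -> a * r < 2 ->
  S <= r ^+ 2 / 2 * G ->
  (forall t, 0 < t -> a ^+ 2 * t < 2 ->
     t * G <= S + Z * (t * V / (1 - a ^+ 2 * t / 2))) ->
  S <= Z * (r ^+ 2 / 2 * (V / (1 - a * r / 2) ^+ 2)).
Proof.
move=> S0 Z0 V0 a0 r0 ar2 SG H; have e0 : 0 < 1 - a * r / 2 by lra.
have e2 : 0 < 2 - a * r by lra.
move: a0; rewrite le_eqVlt => /predU1P[a0|a0].
  subst a; rewrite !mul0r subr0 expr1n divr1.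
  apply/ler_addgt0Pr => e ep.
  (* with this [t] the term [r ^+ 2 / 2 * (S / t)] is [e * (S / (S + 1))] *)
  pose t := r ^+ 2 / 2 * (S + 1) / e.
  have S1 : 0 < S + 1 by lra.
  have t0 : 0 < t by rewrite /t divr_gt0// !mulr_gt0// exprn_gt0.
  have := H t t0; rewrite expr0n !mul0r subr0 divr1 => /(_ (ltr0n _ 2)) Ht.
  have Gt : G <= S / t + Z * V.
    rewrite -(ler_pM2l t0) mulrDr [t * (S / t)]mulrC divfK ?gt_eqF//.
    by rewrite [t * (Z * V)]mulrCA.
  apply: (le_trans SG); apply: (@le_trans _ _ (r ^+ 2 / 2 * (S / t + Z * V))).
    by rewrite ler_wpM2l// divr_ge0// sqr_ge0.
  have -> : Z * (r ^+ 2 / 2 * V) = r ^+ 2 / 2 * (Z * V) by ring.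
  rewrite mulrDr [leRHS]addrC lerD2r.
  have -> : r ^+ 2 / 2 * (S / t) = e * (S / (S + 1)).
    by rewrite /t; field; rewrite !gt_eqF.
  by rewrite -[leRHS]mulr1 ler_pM2l// ler_pdivrMr// mul1r; lra.
have t0 : 0 < r / a by rewrite divr_gt0.
have tE : a ^+ 2 * (r / a) = a * r by field; rewrite gt_eqF.
have := H (r / a) t0; rewrite tE => /(_ ar2) Ht.
have : a * r / 2 * (r / a * G) <=
       a * r / 2 * (S + Z * (r / a * V / (1 - a * r / 2))).
  by rewrite ler_pM2l// divr_gt0// mulr_gt0.
have -> : a * r / 2 * (r / a * G) = r ^+ 2 / 2 * G by field; rewrite gt_eqF.
move=> /(le_trans SG) S1.
have : S * (1 - a * r / 2) <= Z * (r ^+ 2 / 2 * (V / (1 - a * r / 2))).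
  rewrite mulrBr mulr1 lerBlDr; apply: (le_trans S1).
  rewrite le_eqVlt; apply/orP; left; apply/eqP.
  by field; rewrite !gt_eqF.
rewrite -ler_pdivlMr// => /le_trans; apply.
rewrite le_eqVlt; apply/orP; left; apply/eqP; field.
by rewrite gt_eqF.
Qed.

Section bernstein.
Context {R : realType} {n : nat} {d : 'I_n -> measure_display}
  {Omega : forall k, measurableType (d k)}.
Notation X := (product_space Omega).
Variable mu_ : forall k, probability (Omega k) R.
Variable mu : probability (product_space Omega) R.
Hypothesis hmu : is_product_measure mu_ mu.
Notation E_ := (cond_expectation mu_).
Notation V_ := (cond_variance mu_).
Variables (f : X -> R) (b : R).
Hypothesis bf : bounded_measurable f.
Hypothesis hb : forall k x, f x - E_ k f x <= b.
Let g := variance_sum mu_ f.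
Let a := interaction_mu mu_ f.
Let V := \int[mu]_x g x.
Let c := b / 3 + a / 2.

Let bg : bounded_measurable g. Proof. exact: (bm_variance_sum mu_ mu). Qed.
Let g0 x : 0 <= g x. Proof. exact: variance_sum_ge0. Qed.
Let a0 : 0 <= a. Proof. by rewrite /a /interaction_mu mulr_ge0// sqrtr_ge0. Qed.

Hypothesis b0 : 0 <= b.

(** On the fiber of index [k] the function [f - E_ k f] is at most [b] and its
    second moment is the conditional variance; Jensen's inequality turns the
    factor [expR (s * E_ k f)] into [E_ k (expR (s * f))]. *)
Lemma ent_bernstein s : 0 < s -> s * b < 3 ->
  ent mu (fun x => s * f x) <=
  (s / (1 - s * b / 3)) ^+ 2 / 2 * \int[mu]_x (g x * expR (s * f x)).
Proof.
move=> s0 sb3; have bsf : bounded_measurable (fun x => s * f x) by bm.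
set r := (s / (1 - s * b / 3)) ^+ 2 / 2.
have r0 : 0 <= r by rewrite /r divr_ge0// sqr_ge0.
have bV k := bm_cond_variance mu_ mu k bf.
pose F k x := V_ k f x * expR (s * f x).
have bF k : bounded_measurable (F k) by have := bV k; rewrite /F => ?; bm.
have step k x : cond_ent mu_ k (fun x => s * f x) x <= r * E_ k (F k) x.
  set e := E_ k f x.
  have bfx := bm_fiber k x bf.
  rewrite /cond_ent.
  have -> : (fun y => s * f (dfwith x k y)) =
      (fun y => s * (f (dfwith x k y) - e) + s * e).
    by apply/funext => y; ring.
  rewrite entD; last by bm.
  have bc : bounded_measurable (fun y => s * (f (dfwith x k y) - e)) by bm.
  have sb : 0 <= s * b < 3 by rewrite mulr_ge0 ?(ltW s0).
  have le_sb y : s * (f (dfwith x k y) - e) <= s * b.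
    rewrite ler_pM2l//; have := hb k (dfwith x k y).
    by rewrite (indep_cond mu_ f).
  have bennett : ent (mu_ k) (fun y => s * (f (dfwith x k y) - e)) <= r * V_ k f x.
    apply: (le_trans (ent_bennett (mu_ k) bc sb le_sb)).
    rewrite cond_varianceE (@E_eq _ _ _ _ _ (fun y => s ^+ 2 * (f (dfwith x k y) - e) ^+ 2)).
      rewrite EZ; last by bm.
      rewrite -/e le_eqVlt; apply/orP; left; apply/eqP; rewrite /r.
      move: (\int[_]_y _) => I; field; rewrite gt_eqF//; lra.
    by move=> y; rewrite exprMn.
  have jensen : expR (s * e) <= E_ k (fun x => expR (s * f x)) x.
    rewrite /cond_expectation /subst_op -expR_lmgf; last by bm.
    rewrite ler_expR; apply: le_trans (lmgf_ge _ _); last by bm.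
    by rewrite EZ.
  have -> : E_ k (F k) x = V_ k f x * E_ k (fun x => expR (s * f x)) x.
    apply: (condM mu_ (g := V_ k f)); last by bm.
    exact: (indep_cond mu_ (fun x => (f x - E_ k f x) ^+ 2)).
  apply: (le_trans (ler_wpM2l (expR_ge0 _) bennett)).
  rewrite mulrC mulrA ler_wpM2l// mulr_ge0//; exact: cond_variance_ge0.
apply: (le_trans (ent_tensorization hmu bsf)).
have bEF k : bounded_measurable (E_ k (F k)) by exact: (bm_cond _ mu).
apply: (@le_trans _ _ (\int[mu]_x (\sum_(k < n) r * E_ k (F k) x))).
  apply: E_le.
  - by apply: bm_sum => k; exact: (bm_cond_ent mu_ mu).
  - by apply: bm_sum => k; have := bEF k => ?; bm.
  - by move=> x; apply: ler_sum => k _; exact: step.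
rewrite E_sum; last by move=> k; have := bEF k => ?; bm.
rewrite (eq_bigr (fun k => r * \int[mu]_x F k x)); last first.
  by move=> k _; rewrite EZ// (E_cond hmu).
rewrite -mulr_sumr -E_sum//; apply: ler_wpM2l => //.
rewrite le_eqVlt; apply/orP; left; apply/eqP; apply: E_eq => x.
by rewrite /g /variance_sum mulr_suml.
Qed.

(** The sum [g] of the conditional variances is decoupled from the density
    proportional to [expR (s * f)] by [ent_dv]; the exponential moments of [g]
    that this brings in are under control as [g] is self-bounding. *)
Lemma ent_le_variance s : 0 < s -> c * s < 1 ->
  ent mu (fun x => s * f x) <=
  (\int[mu]_x expR (s * f x)) * (s ^+ 2 / 2 * (V / (1 - c * s) ^+ 2)).
Proof.
move=> s0 cs; have bsf : bounded_measurable (fun x => s * f x) by bm.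
have as0 : 0 <= a * s by rewrite mulr_ge0// ltW.
have bs0 : 0 <= b * s by rewrite mulr_ge0// ltW.
have csE : c * s = b * s / 3 + a * s / 2 by rewrite /c; ring.
have sb3 : s * b < 3 by lra.
have q0 : 0 < 1 - s * b / 3 by lra.
pose r := s / (1 - s * b / 3).
have r0 : 0 < r by rewrite /r divr_gt0.
have ar : a * r < 2 by rewrite /r mulrA ltr_pdivrMr//; lra.
have -> : s ^+ 2 / 2 * (V / (1 - c * s) ^+ 2) = r ^+ 2 / 2 * (V / (1 - a * r / 2) ^+ 2).
  have h1 : 1 - s * b / 3 != 0 by rewrite gt_eqF.
  have h2 : 1 - a * r / 2 != 0 by rewrite gt_eqF//; lra.
  have rE : 1 - c * s = (1 - a * r / 2) * (1 - s * b / 3).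
    rewrite csE /r; field; lra.
  have rs : s = r * (1 - s * b / 3) by rewrite /r divfK.
  rewrite rE [in s ^+ 2]rs; move: (1 - s * b / 3) (1 - a * r / 2) h1 h2 => q e q1 e1.
  by field; rewrite q1 e1.
apply: (@decoupled_entropy_bound _ _ (\int[mu]_x (g x * expR (s * f x)))) => //.
- exact: ent_ge0.
- exact: E_expR_gt0.
- exact: E_ge0.
- exact: ent_bernstein.
move=> t t0 at2; have btg : bounded_measurable (fun x => t * g x) by bm.
have -> : t * \int[mu]_x (g x * expR (s * f x)) =
    \int[mu]_x (t * g x * expR (s * f x)).
  by rewrite -EZ; [apply: E_eq => x; rewrite mulrA|bm].
apply: (le_trans (ent_dv mu bsf btg)); rewrite lerD2l.
apply: ler_wpM2l; first by rewrite ltW// E_expR_gt0.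
apply: lmgf_self_bounded => // [|u /andP[u0 _]]; first exact: sqr_ge0.
exact: ent_variance_sum.
Qed.

Lemma lmgf_le_variance s : 0 < s -> c * s < 1 ->
  lmgf mu (fun x => s * f x) <=
  s * \int[mu]_x f x + s ^+ 2 / 2 * (V / (1 - c * s)).
Proof.
move=> s0 cs; have c0 : 0 <= c by rewrite /c addr_ge0// divr_ge0.
apply: lmgf_herbst => //; first exact: E_ge0.
move=> u /andP[u0 us]; apply: ent_le_variance => //.
by apply: le_lt_trans cs; exact: ler_wpM2l.
Qed.

End bernstein.

Lemma prob_le_E (R : realType) d (T : measurableType d) (P : probability T R)
    (A : set T) (h : T -> R) : measurable A -> bounded_measurable h ->
  (forall x, 0 <= h x) -> (forall x, A x -> 1 <= h x) ->
  (P A <= (\int[P]_x h x)%:E)%E.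
Proof.
move=> mA bh h0 h1.
have bA : bounded_measurable (\1_A : T -> R).
  apply/bmP; split; first exact: measurable_indic.
  by exists 1 => x; rewrite indicE; case: (_ \in _); rewrite ?normr1 ?normr0.
have -> : P A = (\int[P]_x \1_A x)%:E.
  rewrite /Rintegral fineK ?integral_indic ?setIT//.
  exact: fin_num_measure.
rewrite lee_fin; apply: E_le => // x; rewrite indicE.
by case: (boolP (x \in A)) => [|_]; [rewrite inE; exact: h1|exact: h0].
Qed.

Lemma fine_expectation (R : realType) d (T : measurableType d) (P : probability T R)
    (f : T -> R) : fine 'E_P[f] = \int[P]_x f x.
Proof. by rewrite unlock. Qed.

Lemma fine_variance (R : realType) d (T : measurableType d) (P : probability T R)
    (f : T -> R) : fine 'V_P[f] = \int[P]_x ((f x - \int[P]_y f y) ^+ 2).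
Proof. by rewrite /variance unlock fine_expectation unlock. Qed.

Theorem corollary5 (R : realType) (n : nat) (d : 'I_n -> measure_display)
    (Omega : forall k : 'I_n, measurableType (d k))
    (mu_ : forall k : 'I_n, probability (Omega k) R)
    (mu : probability (product_space Omega) R)
    (hmu : is_product_measure mu_ mu)
    (f : product_space Omega -> R) (hf : bounded_measurable f) (b : R)
    (hb : forall (k : 'I_n) (x : product_space Omega),
        f x - cond_expectation mu_ k f x <= b)
    (t : R) (ht : 0 < t) :
  (mu [set x | (f x - fine 'E_mu[f] > t)%R] <=
     expeR (neg_quotient (t ^+ 2)
       (2 * fine 'V_mu[f] + interaction f ^+ 2 / 2
        + (2 * b / 3 + interaction_mu mu_ f) * t)%R))%E.
Proof.
rewrite fine_expectation fine_variance.
set m := \int[mu]_x f x; set v := \int[mu]_x _.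
set A := [set x | _].
have bfm : bounded_measurable (fun x => f x - m) by bm.
have mA : measurable A.
  rewrite /A -[X in measurable X]setTI.
  exact: (measurable_fun_ltr (measurable_cst t) (proj1 bfm)) measurableT [set true] _.
have v0 : 0 <= v by apply: E_ge0 => x; exact: sqr_ge0.
move: v0; rewrite le_eqVlt => /predU1P[v0|v0].
  (* zero variance: Chebyshev's inequality shows that [A] is negligible; the
     denominator can vanish in this case only *)
  have : (mu A <= (\int[mu]_x (t ^- 2 * (f x - m) ^+ 2))%:E)%E.
    apply: prob_le_E => //; first by bm.
      by move=> x; rewrite mulr_ge0 ?sqr_ge0// invr_ge0 sqr_ge0.
    move=> x; rewrite /A/= => tx.
    rewrite mulrC ler_pdivlMr ?exprn_gt0// mul1r.
    by rewrite lerXn2r ?nnegrE ?(ltW tx)// ?(ltW ht)// ltW// (lt_trans ht).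
  rewrite EZ; last by bm.
  by rewrite -/v -v0 mulr0 => /le_trans; apply; exact: expeR_ge0.
set J := interaction f; set a := interaction_mu mu_ f.
have a0 : 0 <= a by rewrite /a /interaction_mu mulr_ge0// sqrtr_ge0.
have b0 : 0 <= b.
  (* if there is a coordinate then [f - E_ k f] has mean 0 and is at most [b];
     without coordinates [f] is constant and its variance vanishes *)
  have n0 : (0 < n)%N.
    rewrite lt0n; apply/negP => /eqP n0.
    have fc : forall x x', f x = f x'.
      by apply: indep_cst => -[k kn]; exfalso; rewrite n0 in kn.
    suff : v = 0 by move=> v00; rewrite v00 ltxx in v0.
    rewrite /v (@E_eq _ _ _ _ _ (fun=> 0)) ?E_cst// => x.
    rewrite /m (@E_eq _ _ _ _ _ (fun=> f x)); last by move=> y; exact: fc.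
    by rewrite E_cst subrr expr0n.
  pose k := Ordinal n0.
  have bE := bm_cond mu_ mu k hf.
  rewrite -(E_cst mu b) -(subrr (\int[mu]_x f x)) -{2}(E_cond hmu k hf) -EB//.
  by apply: E_le; [bm|bm|exact: hb].
pose V := \int[mu]_x variance_sum mu_ f x.
pose W := v + J ^+ 2 / 4.
have VW : V <= W.
  have := reverse_efron_stein hmu hf; rewrite -/v -/V => /le_trans h.
  have : 2 * (V - v) <= J ^+ 2 / 2.
    apply: h; rewrite -[leRHS](E_cst mu); apply: E_le; try by bm.
      apply: bm_sum => k; apply: bm_sum => l; apply: (bm_cond_variance mu_ mu).
      exact: (bm_centered mu_ mu).
    by move=> x; exact: (interaction_bound mu_ mu).
  by rewrite /W; lra.
have W0 : 0 < W by rewrite /W ltr_wpDr// divr_ge0// sqr_ge0.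
pose c := b / 3 + a / 2.
have c0 : 0 <= c by rewrite /c addr_ge0// divr_ge0.
have ct0 : 0 <= c * t by rewrite mulr_ge0// ltW.
have D0 : 0 < W + c * t by rewrite ltr_wpDr.
have -> : 2 * v + J ^+ 2 / 2 + (2 * b / 3 + a) * t = 2 * (W + c * t).
  by rewrite /W /c; field.
rewrite /neg_quotient ifF; last by rewrite gt_eqF// mulr_gt0.
(* Bernstein's choice: [1 - c * s] becomes [W / (W + c * t)], and the exponent
   [s ^+ 2 / 2 * (W / (1 - c * s)) - s * t] half of [- s * t] *)
pose s := t / (W + c * t).
have s0 : 0 < s by rewrite /s divr_gt0.
have cs1 : 1 - c * s = W / (W + c * t) by rewrite /s; field; rewrite gt_eqF.
have cs : c * s < 1 by rewrite -subr_gt0 cs1 divr_gt0.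
have : (mu A <= (\int[mu]_x expR (s * f x - (s * (m + t))))%:E)%E.
  apply: prob_le_E => //; first by bm.
  move=> x; rewrite /A/= => tx; rewrite -expR0 ler_expR subr_ge0.
  by rewrite ler_pM2l//; lra.
move=> /le_trans; apply.
have bsf : bounded_measurable (fun x => s * f x) by bm.
rewrite -expR_lmgf; last by bm.
rewrite lmgfB//= lee_fin ler_expR.
have := lmgf_le_variance hmu hf hb b0 s0 cs; rewrite -/m -/V.
have : s ^+ 2 / 2 * (V / (1 - c * s)) <= s ^+ 2 / 2 * (W / (1 - c * s)).
  by rewrite ler_wpM2l ?divr_ge0 ?sqr_ge0// ler_wpM2r// invr_ge0 subr_ge0 ltW.
have -> : s ^+ 2 / 2 * (W / (1 - c * s)) = t ^+ 2 / (2 * (W + c * t)).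
  by rewrite cs1 /s; field; rewrite !gt_eqF.
have -> : - t ^+ 2 / (2 * (W + c * t)) =
   t ^+ 2 / (2 * (W + c * t)) - s * t by rewrite /s; field; rewrite gt_eqF.
rewrite mulrDr; move: (lmgf _ _) (s ^+ 2 / 2 * _) (t ^+ 2 / _) => l p q; lra.
Qed.
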